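(* Let $M$ be a real smooth $n$-dimensional manifold and let $L:T^2M\to\mathbb{R}$ be a regular second order Lagrangian, with metric tensor $g_{ij}=\frac12\frac{\partial^2L}{\partial y^{(2)i}\partial y^{(2)j}}$ and inverse matrix $(g^{ij})$. Then the semispray on $T^2M$ whose local coefficients $G^j$ are given, in every induced chart, by $$3G^{j}=\frac12 g^{ji}\left[d_T\left(\frac{\partial L}{\partial y^{(2)i}}\right)-\frac{\partial L}{\partial y^{(1)i}}\right],\qquad d_T=y^{(1)i}\frac{\partial}{\partial x^i}+2y^{(2)i}\frac{\partial}{\partial y^{(1)i}},$$ is the only semispray $S$ on $T^2M$ that satisfies $$\mathcal{L}_S\left(d_{J^2}L\right)=d_JL,$$ where $\mathcal{L}_S$ is the Lie derivative along $S$.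
   Context: $T^2M$ is the second order tangent bundle (2-jets at $0$ of curves in $M$). A chart $(x^i)$ on $M$ induces coordinates $(x^i,y^{(1)i},y^{(2)i})$ on $T^2M$ by $y^{(\alpha)i}(j^2_0\rho)=\frac{1}{\alpha!}\frac{d^\alpha(x^i\circ\rho)}{dt^\alpha}\big|_{t=0}$, $\alpha=1,2$. All objects are smooth; the summation convention is used. The second order tangent structure is the globally defined endomorphism $J=\frac{\partial}{\partial y^{(1)i}}\otimes dx^i+\frac{\partial}{\partial y^{(2)i}}\otimes dy^{(1)i}$ of $TT^2M$. The Liouville vector field ${\mathbb C}_2$ is $y^{(1)i}\frac{\partial}{\partial y^{(1)i}}+2y^{(2)i}\frac{\partial}{\partial y^{(2)i}}$. A semispray is a global vector field $S$ on $T^2M$ with $JS={\mathbb C}_2$; locally $S=y^{(1)i}\frac{\partial}{\partial x^i}+2y^{(2)i}\frac{\partial}{\partial y^{(1)i}}-3G^i(x,y^{(1)},y^{(2)})\frac{\partial}{\partial y^{(2)i}}$, and the functions $G^i$ are called its coefficients. A second order Lagrangian is a function $L:T^2M\to\mathbb{R}$; it is regular if the matrix $g_{ij}=\frac12\frac{\partial^2L}{\partial y^{(2)i}\partial y^{(2)j}}$ has rank $n$ everywhere on $T^2M$. The Cartan-Poincaré one-forms are $d_JL=dL\circ J=\frac{\partial L}{\partial y^{(1)i}}dx^i+\frac{\partial L}{\partial y^{(2)i}}dy^{(1)i}$ and $d_{J^2}L=dL\circ J^2=\frac{\partial L}{\partial y^{(2)i}}dx^i$. *)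

(* Defs.v *)
(* Built on MathComp and MathComp-Analysis. *)
From HB Require Import structures.
From mathcomp Require Import all_boot all_order all_algebra.
From mathcomp Require Import all_classical all_reals all_analysis.
Set Implicit Arguments.
Unset Strict Implicit.
Unset Printing Implicit Defensive.
Import Order.TTheory GRing.Theory Num.Theory numFieldNormedType.Exports.
Local Open Scope classical_set_scope.
Local Open Scope ring_scope.

(* [U] is meant to be open and [V] finite-dimensional; there the iterated
   directional derivatives 'D_v account for all partial derivatives. *)
Fixpoint Ck_on (R : realType) (V W : normedModType R) (k : nat) (U : set V)
    (f : V -> W) : Prop :=
  match k with
  | 0 => forall x, U x -> {for x, continuous f}
  | k'.+1 => (forall x, U x -> differentiable f x) /\
             forall v, Ck_on k' U (fun x => 'D_v f x)
  end.

Definition smooth_on (R : realType) (V W : normedModType R) (U : set V)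
    (f : V -> W) : Prop := forall k, Ck_on k U f.

(* Bare chart data modelled on the space of k x n matrices: a chart [c] is the
   coordinate map [crd c], relevant only on its domain [dom c].  The model is
   'rV_n for M itself, and 'M_(3, n) for T^2M, with rows x, y^(1), y^(2). *)
Record charted_space (R : realType) (k n : nat) := ChartedSpace {
  carrier :> Type;
  idx : Type;
  dom : idx -> set carrier;
  crd : idx -> carrier -> 'M[R]_(k, n) }.

Arguments idx {R k n}.
Arguments dom {R k n c}.
Arguments crd {R k n c}.

Section ChartedSpace.
Context {R : realType} {k n : nat} {X : charted_space R k n}.

Definition img (c : idx X) : set 'M[R]_(k, n) := crd c @` dom c.

(* Local representative f o c^-1 of f, extended by 0 outside [img c].  The
   preimage point is unique, since charts are injective on their domains. *)
Definition loc (V : zmodType) (c : idx X) (f : X -> V) (x : 'M[R]_(k, n)) : V :=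
  match pselect (exists p, dom c p /\ crd c p = x) with
  | left h => f (projT1 (cid h))
  | right _ => 0
  end.

Definition transition (c c' : idx X) : 'M[R]_(k, n) -> 'M[R]_(k, n) :=
  loc c (crd c').

Definition smooth_atlas : Prop :=
  [/\ (forall p : X, exists c : idx X, dom c p),
      (forall (c : idx X) (p q : X), dom c p -> dom c q -> crd c p = crd c q -> p = q),
      (forall c c' : idx X, open (crd c @` (dom c `&` dom c'))) &
      (forall c c' : idx X, smooth_on (crd c @` (dom c `&` dom c'))
                      (transition c c'))].

Definition smooth_fun (f : X -> R) : Prop :=
  forall c : idx X, smooth_on (img c) (loc c f : 'M[R]_(k, n) -> R).

(* A tangent vector at p: one component vector for each chart around p,
   related by the differentials of the coordinate changes.  The components in
   charts away from p are set to 0, so that equality of tangent vectors is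
   equality of their components around p. *)
Record tangent (p : X) := Tangent {
  tcomp :> idx X -> 'M[R]_(k, n);
  tcomp_transition : forall c c' : idx X, dom c p -> dom c' p ->
    tcomp c' = 'd (transition c c') (crd c p) (tcomp c);
  tcomp_out : forall c : idx X, ~ dom c p -> tcomp c = 0 }.

Definition section_loc (S : forall p, tangent p) (c : idx X) :
    'M[R]_(k, n) -> 'M[R]_(k, n) :=
  loc c (fun p => tcomp (S p) c).

Record vector_field := VectorField {
  vf_at :> forall p, tangent p;
  vf_smooth : forall c : idx X, smooth_on (img c) (section_loc vf_at c) }.

Definition vf_loc (S : vector_field) (c : idx X) := section_loc S c.

(* A one-form, given by its representative in each chart:
   [w c x v] is the value at x in [img c] on the vector with components v. *)
Definition local_form : Type := idx X -> 'M[R]_(k, n) -> 'M[R]_(k, n) -> R.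

Definition form_eq (w w' : local_form) : Prop :=
  forall c x v, img c x -> w c x v = w' c x v.

Definition dform (f : X -> R) : local_form :=
  fun c x v => 'D_v (loc c f : 'M[R]_(k, n) -> R) x.

Definition form_comp (w : local_form)
    (E : 'M[R]_(k, n) -> 'M[R]_(k, n)) : local_form :=
  fun c x v => w c x (E v).

(* (L_S w)(V) = S(w(V)) - w([S, V]) with V of constant components v in the
   chart, for which [S, V] = - D_v S; that is, in coordinates,
   (L_S w)_i = S^j d_j w_i + w_j d_i S^j. *)
Definition Lie_derivative (S : vector_field) (w : local_form) : local_form :=
  fun c x v => 'D_(vf_loc S c x) (fun y => w c y v) x
               + w c x ('D_v (vf_loc S c) x).

End ChartedSpace.

Arguments smooth_atlas {R k n} X.
Arguments vector_field {R k n} X.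
Arguments local_form {R k n} X.

Record smooth_manifold (R : realType) (n : nat) := SmoothManifold {
  space :> topologicalType;
  space_hausdorff : hausdorff_space space;
  space_countable : @second_countable space;
  mchart : Type;
  mdom : mchart -> set space;
  mcrd : mchart -> space -> 'rV[R]_n;
  mdom_open : forall c, open (mdom c);
  mcrd_continuous : forall c p, mdom c p -> {for p, continuous (mcrd c)};
  mcrd_open : forall c (U : set space),
    open U -> U `<=` mdom c -> open (mcrd c @` U);
  matlas : smooth_atlas (ChartedSpace mdom mcrd) }.

Arguments mdom {R n s}.
Arguments mcrd {R n s}.

Section SecondOrderTangentBundle.
Context {R : realType} {n : nat}.
Variable M : smooth_manifold R n.

(* The curve is defined and smooth near 0; its other values are irrelevant. *)
Definition smooth_curve (rho : R -> M) : Prop :=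
  exists (c : mchart M) (U : set R),
    [/\ open U, U 0, rho @` U `<=` mdom c & smooth_on U (mcrd c \o rho)].

Definition same_jet2 (rho sigma : R -> M) : Prop :=
  rho 0 = sigma 0 /\
  forall c, mdom c (rho 0) -> forall a, (a <= 2)%N ->
    derive1n a (mcrd c \o rho) 0 = derive1n a (mcrd c \o sigma) 0.

Record jet2 := Jet2 {
  jet_class : set (R -> M);
  jet_classP : exists2 rho, smooth_curve rho &
    jet_class = [set sigma | smooth_curve sigma /\ same_jet2 rho sigma] }.

Definition jet_repr (j : jet2) : R -> M := s2val (cid2 (jet_classP j)).

(* y^(a)i = 1/a! d^a(x^i o rho)/dt^a at t = 0, with y^(0) = x. *)
Definition jet_crd (c : mchart M) (j : jet2) : 'M[R]_(3, n) :=
  \matrix_(a < 3, i < n)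
    ((a`!)%:R^-1 * derive1n a (mcrd c \o jet_repr j) 0 0 i).

(* The charts induced on T^2M by the charts of M. *)
Definition T2 : charted_space R 3 n :=
  ChartedSpace (fun c => [set j : jet2 | mdom c (jet_repr j 0)]) jet_crd.

End SecondOrderTangentBundle.

Definition rx : 'I_3 := @Ordinal 3 0 isT.
Definition ry1 : 'I_3 := @Ordinal 3 1 isT.
Definition ry2 : 'I_3 := @Ordinal 3 2 isT.

(* Components, in an induced chart, of the tangent structure
   J = d/dy1^i (x) dx^i + d/dy2^i (x) dy1^i, which shifts the rows down. *)
Definition Jtan (R : realType) (n : nat) (v : 'M[R]_(3, n)) : 'M[R]_(3, n) :=
  (\matrix_(a < 3, b < 3) ((a : nat) == b.+1)%:R) *m v.

(* Row a is a * y^(a), i.e. (0, y1, 2 y2). *)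
Definition Liouville2 (R : realType) (n : nat) (x : 'M[R]_(3, n)) :
    'M[R]_(3, n) :=
  \matrix_(a < 3, i < n) (a%:R * x a i).

Definition partial_d (R : realType) (n : nat) (a : 'I_3) (i : 'I_n)
    (f : 'M[R]_(3, n) -> R) (x : 'M[R]_(3, n)) : R :=
  'D_(delta_mx a i) f x.

Definition dT (R : realType) (n : nat) (f : 'M[R]_(3, n) -> R)
    (x : 'M[R]_(3, n)) : R :=
  \sum_(i < n) (x ry1 i * partial_d rx i f x
                + 2 * x ry2 i * partial_d ry1 i f x).

Section SecondOrderLagrangian.
Context {R : realType} {n : nat} {M : smooth_manifold R n}.

Definition semispray (S : vector_field (T2 M)) : Prop :=
  forall (p : T2 M) (c : idx (T2 M)), dom c p ->
    Jtan (S p c) = Liouville2 (crd c p).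

Definition semispray_coef (S : vector_field (T2 M)) (c : idx (T2 M))
    (x : 'M[R]_(3, n)) (i : 'I_n) : R :=
  - 3^-1 * vf_loc S c x ry2 i.

Definition metric (L : T2 M -> R) (c : idx (T2 M)) (x : 'M[R]_(3, n)) :
    'M[R]_n :=
  \matrix_(i < n, j < n)
    (2^-1 * partial_d ry2 i (partial_d ry2 j (loc c L)) x).

Definition regular (L : T2 M -> R) : Prop :=
  forall c x, img c x -> \rank (metric L c x) = n.

Definition dJ (L : T2 M -> R) : local_form (T2 M) :=
  form_comp (dform L) (@Jtan R n).

Definition dJ2 (L : T2 M -> R) : local_form (T2 M) :=
  form_comp (dform L) (@Jtan R n \o @Jtan R n).

End SecondOrderLagrangian.

(* Main.v *)
Require Import Defs.
From HB Require Import structures.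
From mathcomp Require Import all_boot all_order all_algebra.
From mathcomp Require Import all_classical all_reals all_analysis.
From mathcomp Require Import ring.
Set Implicit Arguments.
Unset Strict Implicit.
Unset Printing Implicit Defensive.
Import Order.TTheory GRing.Theory Num.Theory numFieldNormedType.Exports.
Local Open Scope classical_set_scope.
Local Open Scope ring_scope.

(** For a semispray S one has J^2 S = J C_2 = y^(1) d/dy^(2), so J^2 [S, V] is the
    same for all semisprays, and L_S (d_{J^2} L) = d_J L reduces in an induced chart to
    S (dL/dy^(2)i) = dL/dy^(1)i.  Only the last row of S is free, and it enters through
    the matrix 2 g_ij: the equation is an invertible linear system at each point, whose
    solution is the announced formula.  A coordinate change of M induces on T^2M
    (x, y1, y2) |-> (phi x, D_y1 phi, D_y2 phi + 1/2 D_y1 D_y1 phi), and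
    differentiating L = L' o Phi shows that its differential carries semispray vectors
    solving the equation to semispray vectors solving it; by pointwise uniqueness the
    local solutions are therefore the components of one global vector field. *)

(** * Differentiation along moving directions *)

(** The obstacle is that ['D_v] differentiates along a fixed vector, whereas the lift of phi to T^2M
    differentiates phi along rows of the variable itself. Hence the calculus of maps y |-> D_(b y)
    psi (a y), where base point and direction both move. The equation at a point involves only the
    value s of S there: the derivatives of S enter through its first row alone, and that row is
    prescribed. Existence, uniqueness and transport can thus be argued for single vectors, and
    smoothness is read off the explicit formula. Symmetry of second derivatives enters three times:
    in the y1-derivative of the lift, in the symmetry of g_ij, and in reducing the equation to basis
    covectors. *)

Lemma near_eq_differentiable (R : realType) (V W : normedModType R)
    (f g : V -> W) (x : V) :
  (\near x, f x = g x) -> differentiable f x -> differentiable g x.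
Proof.
move=> fg df; have /diff_locallyP[cf ef] := df.
have eg : g \o shift x = cst (g x) + 'd f x +o_ 0 id.
  apply/eqaddoP => e e0; have /eqaddoP/(_ e e0) := ef.
  have : \forall h \near 0, f (h + x) = g (h + x).
    by move: fg; rewrite (near_shift 0 x) /= subr0.
  rewrite !near_simpl => fgh; apply: filterS2 fgh => h /= fgh.
  by rewrite /= !fctE /= fgh (nbhs_singleton fg).
have dE : 'd g x = 'd f x :> (V -> W) by exact: diff_unique.
by apply/diff_locallyP; rewrite dE.
Qed.

Lemma derive_comp (R : realType) (U V W : normedModType R)
    (f : U -> V) (g : V -> W) (x v : U) :
  differentiable f x -> differentiable g (f x) ->
  'D_v (g \o f) x = 'D_('D_v f x) g (f x).
Proof.
move=> df dg; rewrite !deriveE //; last exact: differentiable_comp.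
by rewrite diff_comp.
Qed.

Section DirectionLinearity.
Variables (R : realType) (V W : normedModType R) (f : V -> W) (x : V).
Hypothesis df : differentiable f x.

Lemma derive_dirD u v : 'D_(u + v) f x = 'D_u f x + 'D_v f x.
Proof. by rewrite !deriveE // linearD. Qed.

Lemma derive_dirZ a v : 'D_(a *: v) f x = a *: 'D_v f x.
Proof. by rewrite !deriveE // linearZ. Qed.

Lemma derive_dir_sum I (r : seq I) (F : I -> V) :
  'D_(\sum_(i <- r) F i) f x = \sum_(i <- r) 'D_(F i) f x.
Proof.
by rewrite deriveE // linear_sum; apply: eq_bigr => i _; rewrite deriveE.
Qed.

End DirectionLinearity.

(** This turns a variable direction into variable scalar coefficients of derivatives along fixed
    matrix units, to which the product rule applies. *)
Lemma derive_mx_dir (R : realType) (W : normedModType R) m n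
    (f : 'M[R]_(m, n) -> W) (x v : 'M[R]_(m, n)) : differentiable f x ->
  'D_v f x = \sum_(p : 'I_m * 'I_n) v p.1 p.2 *: 'D_(delta_mx p.1 p.2) f x.
Proof.
move=> df; rewrite {1}(matrix_sum_delta v) pair_big /= derive_dir_sum //.
by apply: eq_bigr => p _; rewrite derive_dirZ.
Qed.

Section BigSum.
Variables (R : realType) (V W : normedModType R) (x : V).
Variables (I : Type) (r : seq I) (P : pred I) (f : I -> V -> W).
Hypothesis df : forall i, differentiable (f i) x.

Let big_sumE : (fun y => \sum_(i <- r | P i) f i y) = \sum_(i <- r | P i) f i.
Proof. by rewrite fct_sumE. Qed.

Lemma differentiable_bigsum :
  differentiable (fun y => \sum_(i <- r | P i) f i y) x.
Proof.
rewrite big_sumE; elim/big_rec: _ => [|i g _ dg]; first exact: differentiable_cst.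
exact: differentiableD.
Qed.

Lemma derive_bigsum v :
  'D_v (fun y => \sum_(i <- r | P i) f i y) x = \sum_(i <- r | P i) 'D_v (f i) x.
Proof.
rewrite big_sumE; suff [] : differentiable (\sum_(i <- r | P i) f i) x /\
  'D_v (\sum_(i <- r | P i) f i) x = \sum_(i <- r | P i) 'D_v (f i) x by [].
elim/big_rec2: _ => [|i a g _ [dg Dg]].
  by split; [exact: differentiable_cst | exact: derive_cst].
split; first exact: differentiableD.
by rewrite deriveD ?Dg //; exact: diff_derivable.
Qed.

End BigSum.

Lemma differentiable_mxP (R : realType) (V : normedModType R) m n
    (f : V -> 'M[R]_(m, n)) (x : V) :
  differentiable f x <-> forall i j, differentiable (fun y => f y i j : R) x.
Proof.
split=> [df i j|df].
  exact: (differentiable_comp df (differentiable_coord (f x) i j)).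
have -> : f = fun y => \sum_(k < m) \sum_(l < n) f y k l *: delta_mx k l.
  by apply/funext => y; rewrite [LHS]matrix_sum_delta.
apply: differentiable_bigsum => k; apply: differentiable_bigsum => l.
exact: differentiableZl.
Qed.

Lemma derive_mxE (R : realType) (V : normedModType R) m n
    (f : V -> 'M[R]_(m, n)) (x v : V) i j :
  differentiable f x -> ('D_v f x) i j = 'D_v (fun y => f y i j : R) x.
Proof. by move=> df; rewrite derive_mx ?mxE //; exact: diff_derivable. Qed.

Lemma differentiable_mulmxl (R : realType) m n p (A : 'M[R]_(m, n))
    (x : 'M[R]_(n, p)) : differentiable (mulmx A) x.
Proof.
apply/differentiable_mxP => i j.
under eq_fun do rewrite mxE.
apply: (@differentiable_bigsum R _ R) => k.
by apply: differentiableZ; exact: differentiable_coord.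
Qed.

Lemma derive_mulmxl (R : realType) m n p (A : 'M[R]_(m, n))
    (x v : 'M[R]_(n, p)) : 'D_v (mulmx A) x = A *m v.
Proof.
have dA := differentiable_mulmxl A x.
rewrite deriveE // (@diff_lin _ _ _ (mulmx A)) // => y.
exact/differentiable_continuous/differentiable_mulmxl.
Qed.

Section ScaleRule.
Variables (R : realType) (V W : normedModType R) (c : V -> R) (f : V -> W).
Variables (x : V).
Hypotheses (dc : differentiable c x) (df : differentiable f x).

(** Scaling is packed as a continuous bilinear map R x W -> W, so that the product rule for a scalar
    function times a [W]-valued one is the differential of a bilinear map. *)
Let scale_bilinear : bilinear_for
  (GRing.Scale.Law.clone _ _ *:%R _) (GRing.Scale.Law.clone _ _ *:%R _)
  (@GRing.scale R W).
Proof.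
split=> [w|k] a u v /=; first by rewrite scalerDl -scalerA.
by rewrite scalerDr !scalerA mulrC.
Qed.

Let scaleM := bilinear_isBilinear.Build R R W W _ _ (@GRing.scale R W)
  scale_bilinear.
Let scaleB : {bilinear R -> W -> W} := HB.pack (@GRing.scale R W) scaleM.

Let cont_scale : continuous (fun p : R * W => scaleB p.1 p.2).
Proof. exact: scale_continuous. Qed.

Lemma differentiable_scale : differentiable (fun y => c y *: f y) x.
Proof.
exact: (differentiable_comp (differentiable_pair dc df)
         (differentiable_bilin (f := scaleB) (c x, f x) cont_scale)).
Qed.

Lemma derive_scale v :
  'D_v (fun y => c y *: f y) x = 'D_v c x *: f x + c x *: 'D_v f x.
Proof.
have dp := differentiable_pair dc df.
have ds := differentiable_bilin (f := scaleB) (c x, f x) cont_scale.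
rewrite deriveE; last exact: differentiable_scale.
have -> : 'd (fun y => c y *: f y) x v =
    'd (fun p => scaleB p.1 p.2) (c x, f x) ('d (fun y => (c y, f y)) x v).
  exact: (congr1 (fun g : V -> W => g v) (diff_comp dp ds)).
by rewrite diff_bilin // diff_pair //= addrC !deriveE.
Qed.

End ScaleRule.

Section MovingDirection.
Variables (R : realType) (V W : normedModType R) (m n : nat).
Variables (U : set 'M[R]_(m, n)) (psi : 'M[R]_(m, n) -> W).
Hypotheses (Uo : open U) (dpsi : forall z, U z -> differentiable psi z).
Variables (a b : V -> 'M[R]_(m, n)) (x : V).
Hypotheses (Ux : U (a x)) (da : differentiable a x) (db : differentiable b x).

Let near_dpsi : \forall y \near x, differentiable psi (a y).
Proof.
have /differentiable_continuous ca := da.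
have : nbhs x (a @^-1` U) by apply: ca; exact: open_nbhs_nbhs.
by apply: filterS => y; exact: dpsi.
Qed.

(** The factors [c] stay abstract because the sum serves twice: with first derivatives of psi, and
    with D_(b y) of these first derivatives. *)
Lemma derive_coord_sum (c : 'I_m * 'I_n -> V -> W) (v : V) :
  (forall p, differentiable (c p) x) ->
  differentiable (fun y => \sum_p b y p.1 p.2 *: c p y) x /\
  'D_v (fun y => \sum_p b y p.1 p.2 *: c p y) x =
    \sum_p ('D_v b x p.1 p.2 *: c p x + b x p.1 p.2 *: 'D_v (c p) x).
Proof.
move=> dc.
have dbp p : differentiable (fun y => b y p.1 p.2 : R) x.
  exact: (differentiable_mxP b x).1.
have dbc p : differentiable (fun y => b y p.1 p.2 *: c p y) x.
  exact: differentiable_scale.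
split; first exact: differentiable_bigsum.
rewrite derive_bigsum //; apply: eq_bigr => p _.
by rewrite derive_scale // derive_mxE.
Qed.

Hypothesis dpsi2 : forall w z, U z -> differentiable ('D_w psi) z.

(** The direction enters linearly, so its variation gives the first term; the second comes from the
    motion of the base point with the direction frozen. *)
Lemma derive_dir_moving (v : V) :
  differentiable (fun y => 'D_(b y) psi (a y)) x /\
  'D_v (fun y => 'D_(b y) psi (a y)) x =
    'D_('D_v b x) psi (a x) + 'D_('D_v a x) ('D_(b x) psi) (a x).
Proof.
pose c p y := 'D_(delta_mx p.1 p.2) psi (a y).
have dc p : differentiable (c p) x.
  exact: (differentiable_comp da (dpsi2 _ Ux)).
have [dS DS] := derive_coord_sum v dc.
have nE : \forall y \near x, \sum_p b y p.1 p.2 *: c p y = 'D_(b y) psi (a y).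
  by near=> y; rewrite derive_mx_dir //; near: y; exact: near_dpsi.
split; first exact: near_eq_differentiable dS.
rewrite -(near_eq_derive _ nE) DS big_split /=; congr (_ + _).
  by rewrite derive_mx_dir //; exact: dpsi.
(* With coefficients frozen at [b x], the sum is D_(b x) psi near [a x], and a single derivative
   along the velocity of [a] remains. *)
transitivity ('D_('D_v a x)
    (fun z => \sum_p b x p.1 p.2 *: 'D_(delta_mx p.1 p.2) psi z) (a x)).
  rewrite derive_bigsum; last by move=> p; apply: differentiableZ; exact: dpsi2.
  apply: eq_bigr => p _; rewrite deriveZ; last exact/diff_derivable/dpsi2.
  have Dc : 'D_v (c p) x = 'D_('D_v a x) ('D_(delta_mx p.1 p.2) psi) (a x).
    exact: (derive_comp v da (dpsi2 _ Ux)).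
  by rewrite Dc.
apply: near_eq_derive; near=> z; rewrite -derive_mx_dir //.
by apply: dpsi; near: z; exact: open_nbhs_nbhs.
Unshelve. all: by end_near. Qed.

End MovingDirection.

Section MovingDirection2.
Variables (R : realType) (V W : normedModType R) (m n : nat).
Variables (U : set 'M[R]_(m, n)) (psi : 'M[R]_(m, n) -> W).
Hypotheses (Uo : open U) (spsi : smooth_on U psi).
Variables (a b : V -> 'M[R]_(m, n)) (x : V).
Hypotheses (Ux : U (a x)) (da : differentiable a x) (db : differentiable b x).

Let dpsi1 z : U z -> differentiable psi z.
Proof. by move=> Uz; have [dp _] := spsi 1; exact: dp. Qed.

Let dpsi2 w z : U z -> differentiable ('D_w psi) z.
Proof. by move=> Uz; have [_ /(_ w)[dp _]] := spsi 2; exact: dp. Qed.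

Let dpsi3 w w' z : U z -> differentiable ('D_w' ('D_w psi)) z.
Proof.
by move=> Uz; have [_ /(_ w)[_ /(_ w')[dp _]]] := spsi 3; exact: dp.
Qed.

(** There are three sources of variation: outer direction, inner direction and base point. Expanding
    only the inner direction over matrix units leaves first-order expressions, to which
    [derive_dir_moving] applies. *)
Lemma derive_dir_moving2 (v : V) :
  differentiable (fun y => 'D_(b y) ('D_(b y) psi) (a y)) x /\
  'D_v (fun y => 'D_(b y) ('D_(b y) psi) (a y)) x =
    'D_('D_v b x) ('D_(b x) psi) (a x) + 'D_(b x) ('D_('D_v b x) psi) (a x)
    + 'D_('D_v a x) ('D_(b x) ('D_(b x) psi)) (a x).
Proof.
pose D p : 'M[R]_(m, n) -> W := 'D_(delta_mx p.1 p.2) psi.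
have DE u w z : U z -> 'D_u ('D_w psi) z = \sum_p w p.1 p.2 *: 'D_u (D p) z.
  move=> Uz; transitivity ('D_u (fun z => \sum_p w p.1 p.2 *: D p z) z).
    apply: near_eq_derive; have : nbhs z U by exact: open_nbhs_nbhs.
    by apply: filterS => z' Uz'; rewrite derive_mx_dir //; exact: dpsi1.
  rewrite derive_bigsum; last by move=> p; apply: differentiableZ; exact: dpsi2.
  by apply: eq_bigr => p _; rewrite deriveZ //; exact/diff_derivable/dpsi2.
pose c p y := 'D_(b y) (D p) (a y).
have cP p : differentiable (c p) x /\ 'D_v (c p) x =
    'D_('D_v b x) (D p) (a x) + 'D_('D_v a x) ('D_(b x) (D p)) (a x).
  by apply: (derive_dir_moving Uo) => // [z|w z] Uz; [exact: dpsi2|exact: dpsi3].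
have dc p : differentiable (c p) x by have [] := cP p.
have [dS DS] := derive_coord_sum db v dc.
have nE : \forall y \near x,
    \sum_p b y p.1 p.2 *: c p y = 'D_(b y) ('D_(b y) psi) (a y).
  have /differentiable_continuous ca := da.
  have : nbhs x (a @^-1` U) by apply: ca; exact: open_nbhs_nbhs.
  by apply: filterS => y Uy; rewrite DE.
split; first exact: near_eq_differentiable dS.
rewrite -(near_eq_derive _ nE) DS.
under eq_bigr => p _ do rewrite (cP p).2 scalerDr addrA.
rewrite big_split /= big_split /=.
have S1 : \sum_p 'D_v b x p.1 p.2 *: c p x =
    'D_(b x) ('D_('D_v b x) psi) (a x) by exact: esym (DE _ _ _ Ux).
have S2 : \sum_p b x p.1 p.2 *: 'D_('D_v b x) (D p) (a x) =
    'D_('D_v b x) ('D_(b x) psi) (a x) by exact: esym (DE _ _ _ Ux).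
have S3 : \sum_p b x p.1 p.2 *: 'D_('D_v a x) ('D_(b x) (D p)) (a x) =
    'D_('D_v a x) ('D_(b x) ('D_(b x) psi)) (a x).
  transitivity ('D_('D_v a x)
      (fun z => \sum_p b x p.1 p.2 *: 'D_(b x) (D p) z) (a x)).
    rewrite derive_bigsum; last first.
      by move=> p; apply: differentiableZ; exact: dpsi3.
    by apply: eq_bigr => p _; rewrite deriveZ //; exact/diff_derivable/dpsi3.
  apply: near_eq_derive; apply: filterS (open_nbhs_nbhs (conj Uo Ux)) => z Uz.
  exact: esym (DE _ _ _ Uz).
apply: etrans (congr2 +%R (congr2 +%R S1 S2) S3) _.
exact: (congr1 (+%R^~ _) (addrC _ _)).
Qed.

End MovingDirection2.

(** * Symmetry of second derivatives *)

Section Schwarz.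
Variables (R : realType) (V : normedModType R).
Implicit Types (f : V -> R) (u v x w : V).

Lemma differentiable_line x u (s : R) : differentiable (fun t : R => x + t *: u) s.
Proof. by apply: differentiableD => //; exact: differentiableZl. Qed.

Lemma derive_line x u (s : R) : 'D_1 (fun t : R => x + t *: u) s = u.
Proof.
have d2 : differentiable (fun t : R => t *: u) s by exact: differentiableZl.
rewrite deriveD; [|exact: diff_derivable..].
rewrite derive_cst add0r deriveE //.
by rewrite (@diffZl _ _ _ id) //= diff_val scale1r.
Qed.

Lemma MVT_line f x u (h : R) : 0 < h ->
  (forall s : R, 0 <= s <= h -> differentiable f (x + s *: u)) ->
  exists2 s, 0 <= s <= h & f (x + h *: u) - f x = h * 'D_u f (x + s *: u).
Proof.
move=> h0 df.
pose g (s : R) := f (x + s *: u).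
have dg s : 0 <= s <= h -> differentiable g s.
  by move=> /df; exact: (differentiable_comp (differentiable_line x u s)).
have Dg s : 0 <= s <= h -> 'D_1 g s = 'D_u f (x + s *: u).
  move=> /df dfs.
  have := @derive_comp R R V R _ f s 1 (differentiable_line x u s) dfs.
  by rewrite derive_line.
have [||s sh gE] := @MVT R g (fun s => 'D_u f (x + s *: u)) 0 h h0.
- move=> s; rewrite in_itv /= => /andP[s0 sh].
  have sI : 0 <= s <= h by rewrite !ltW.
  by rewrite -Dg //; apply/derivableP/diff_derivable/dg.
- apply: derivable_within_continuous => s; rewrite in_itv /= => sI.
  exact/diff_derivable/dg.
exists s; first by move: sh; rewrite in_itv /= => /andP[s0 sh]; rewrite !ltW.
by move: gE; rewrite /g scale0r addr0 subr0 mulrC.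
Qed.

Lemma differentiable_translate f w x :
  differentiable f (x + w) -> differentiable (fun y => f (y + w)) x.
Proof.
have ds : differentiable (fun y : V => y + w) x by exact: differentiableD.
exact: (differentiable_comp ds).
Qed.

Lemma derive_translate f w x u :
  differentiable f (x + w) -> 'D_u (fun y => f (y + w)) x = 'D_u f (x + w).
Proof.
have ds : differentiable (fun y : V => y + w) x by exact: differentiableD.
move=> df; have -> : 'D_u (fun y => f (y + w)) x =
    'D_('D_u (fun y : V => y + w) x) f (x + w) by exact: (derive_comp u ds df).
by rewrite deriveD // derive_id derive_cst addr0.
Qed.

Lemma MVT2 f x u v (h : R) : 0 < h ->
  (forall s t : R, 0 <= s <= h -> 0 <= t <= h ->
     differentiable f (x + s *: u + t *: v)) ->
  (forall s t : R, 0 <= s <= h -> 0 <= t <= h ->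
     differentiable ('D_u f) (x + s *: u + t *: v)) ->
  exists s t, [/\ 0 <= s <= h, 0 <= t <= h &
    f (x + h *: u + h *: v) - f (x + h *: u) - (f (x + h *: v) - f x) =
    h * (h * 'D_v ('D_u f) (x + s *: u + t *: v))].
Proof.
move=> h0 df d2f; have hh : 0 <= h <= h by rewrite lexx ltW.
have h00 : 0 <= (0 : R) <= h by rewrite lexx ltW.
pose g y := f (y + h *: v) - f y.
have dfv s : 0 <= s <= h -> differentiable (fun y => f (y + h *: v)) (x + s *: u).
  by move=> sI; apply: differentiable_translate; exact: df.
have df0 s : 0 <= s <= h -> differentiable f (x + s *: u).
  by move=> sI; have := df s 0 sI h00; rewrite scale0r addr0.
have [|s sI gE] := @MVT_line g x u h h0.
  by move=> s sI; apply: differentiableB; [exact: dfv | exact: df0].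
have [|t tI DE] := @MVT_line ('D_u f) (x + s *: u) v h h0.
  by move=> t tI; exact: d2f.
exists s, t; split => //.
move: gE; rewrite /g => ->; rewrite -DE deriveB.
- by rewrite derive_translate //; exact: df.
- exact/diff_derivable/dfv.
- exact/diff_derivable/df0.
Qed.

(** The second difference is symmetric in u and v, so [MVT2] in both orders makes the two mixed
    derivatives agree at two points of a small parallelogram; continuity at x brings both points to
    x. *)
Lemma derive_derive_sym f (U : set V) x u v : open U -> U x ->
  (forall y, U y -> differentiable f y) ->
  (forall w y, U y -> differentiable ('D_w f) y) ->
  {for x, continuous ('D_v ('D_u f))} -> {for x, continuous ('D_u ('D_v f))} ->
  'D_v ('D_u f) x = 'D_u ('D_v f) x.
Proof.
move=> Uo Ux df d2f c1 c2; apply/eqP; rewrite -subr_eq0 -normr_le0.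
apply/ler_addgt0Pr => e e0; rewrite add0r.
have e20 : 0 < e / 2 by rewrite divr_gt0.
have nU : nbhs x U by exact: open_nbhs_nbhs.
move/cvgrPdist_lt : c1 => /(_ _ e20) n1.
move/cvgrPdist_lt : c2 => /(_ _ e20) n2.
have n12 := filterI nU (filterI n1 n2).
have [d /= d0 dP] := (nbhs_ballP _ _).1 (n12 _ _).
(* This side keeps the whole parallelogram inside the ball of radius d; the summand 1 keeps the
   denominator positive when u = v = 0. *)
pose h := d / (`|u| + `|v| + 1).
have N0 : 0 < `|u| + `|v| + 1 by rewrite ltr_wpDl // addr_ge0.
have h0 : 0 < h by rewrite divr_gt0.
have hd : h * `|u| + h * `|v| < d.
  rewrite -mulrDr /h mulrAC ltr_pdivrMr // ltr_pM2l // ltrDl ltr01 //.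
have ballP a b : 0 <= a <= h -> 0 <= b <= h -> ball x d (x + a *: u + b *: v).
  move=> /andP[a0 ah] /andP[b0 bh]; rewrite -ball_normE /= -addrA opprD addNKr.
  rewrite normrN (le_lt_trans (ler_normD _ _)) // !normrZ !ger0_norm //.
  by apply: le_lt_trans hd; rewrite lerD // ler_wpM2r.
have [s [t [sI tI E1]]] : exists s t, [/\ 0 <= s <= h, 0 <= t <= h &
    f (x + h *: u + h *: v) - f (x + h *: u) - (f (x + h *: v) - f x) =
    h * (h * 'D_v ('D_u f) (x + s *: u + t *: v))].
  by apply: MVT2 => // a b aI bI; [apply: df | apply: d2f];
    have [] := dP _ (ballP _ _ aI bI).
have [t' [s' [tI' sI' E2]]] : exists t s, [/\ 0 <= t <= h, 0 <= s <= h &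
    f (x + h *: v + h *: u) - f (x + h *: v) - (f (x + h *: u) - f x) =
    h * (h * 'D_u ('D_v f) (x + t *: v + s *: u))].
  by apply: MVT2 => // b a bI aI; rewrite addrAC; [apply: df | apply: d2f];
    have [] := dP _ (ballP _ _ aI bI).
have E : 'D_v ('D_u f) (x + s *: u + t *: v) = 'D_u ('D_v f) (x + s' *: u + t' *: v).
  apply: (mulfI (lt0r_neq0 h0)); apply: (mulfI (lt0r_neq0 h0)).
  move: E2; rewrite (addrAC x (h *: v)) (addrAC x (t' *: v)) => E2.
  apply: etrans (esym E1) (etrans _ E2).
  by ring.
have [_ [/= B1 _]] := dP _ (ballP _ _ sI tI).
have [_ [/= _ B2]] := dP _ (ballP _ _ sI' tI').
apply: le_trans (ler_distD ('D_v ('D_u f) (x + s *: u + t *: v)) _ _) _.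
rewrite (splitr e); apply: lerD; apply: ltW; first exact: B1.
by rewrite E distrC; exact: B2.
Qed.

End Schwarz.

(** * Closure properties of smooth maps *)

Section CkOn.
Variables (R : realType) (V : normedModType R).
Implicit Types (W : normedModType R) (k : nat) (U : set V).

Lemma Ck_on_sub W k U U' (f : V -> W) :
  U' `<=` U -> Ck_on k U f -> Ck_on k U' f.
Proof.
move=> UU'; elim: k f => [|k IH] f /=; first by move=> cf x /UU'; exact: cf.
by move=> [df Df]; split=> [x /UU'|v]; [exact: df | exact: IH].
Qed.

Lemma Ck_onW W k U (f : V -> W) : Ck_on k.+1 U f -> Ck_on k U f.
Proof.
elim: k f => [|k IH] f [df Df]; last by split => // v; exact: IH.
by move=> x Ux; exact/differentiable_continuous/df.
Qed.

Lemma smooth_on_differentiable W U (f : V -> W) (x : V) :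
  smooth_on U f -> U x -> differentiable f x.
Proof. by move=> /(_ 1)[df _]; exact: df. Qed.

Lemma smooth_on_derive W U (f : V -> W) (v : V) :
  smooth_on U f -> smooth_on U ('D_v f).
Proof. by move=> sf k; have [_ Df] := sf k.+1; exact: Df. Qed.

Lemma eq_Ck_on W k U (f g : V -> W) : open U ->
  {in U, f =1 g} -> Ck_on k U f -> Ck_on k U g.
Proof.
move=> Uo; elim: k f g => [|k IH] f g fg.
  move=> cf x Ux; rewrite /prop_for /continuous_at -(fg x) ?inE //.
  apply: cvg_trans (cf x Ux); apply: near_eq_cvg.
  have : nbhs x U by exact: open_nbhs_nbhs.
  by apply: filterS => y Uy; rewrite fg ?inE.
have nfg x : U x -> \near x, f x = g x.
  move=> Ux; have : nbhs x U by exact: open_nbhs_nbhs.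
  by apply: filterS => y Uy; rewrite fg ?inE.
move=> [df Df]; split=> [x Ux|v].
  exact: near_eq_differentiable (nfg x Ux) (df x Ux).
apply: IH (Df v) => x; rewrite inE => Ux.
exact/near_eq_derive/nfg.
Qed.

Lemma eq_smooth_on W U (f g : V -> W) : open U ->
  {in U, f =1 g} -> smooth_on U f -> smooth_on U g.
Proof. by move=> Uo fg sf k; exact: eq_Ck_on (sf k). Qed.

Lemma Ck_on_cst W k U (c : W) : Ck_on k U (fun _ : V => c).
Proof.
elim: k c => [|k IH] c /=; first by move=> x _; exact: cvg_cst.
split=> [x _|v]; first exact: differentiable_cst.
by rewrite [X in Ck_on k U X](_ : _ = fun _ => 0) //; apply/funext => x; rewrite derive_cst.
Qed.

Lemma Ck_onD W k U (f g : V -> W) : open U ->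
  Ck_on k U f -> Ck_on k U g -> Ck_on k U (fun x => f x + g x).
Proof.
move=> Uo; elim: k f g => [|k IH] f g.
  by move=> cf cg x Ux; apply: cvgD; [exact: cf | exact: cg].
move=> [df Df] [dg Dg]; split=> [x Ux|v].
  by apply: differentiableD; [exact: df | exact: dg].
apply: (eq_Ck_on Uo) (IH _ _ (Df v) (Dg v)) => x; rewrite inE => Ux.
by rewrite deriveD //; apply: diff_derivable; [exact: df | exact: dg].
Qed.

Lemma Ck_onM k U (f g : V -> R) : open U ->
  Ck_on k U f -> Ck_on k U g -> Ck_on k U (fun x => f x * g x).
Proof.
move=> Uo; elim: k f g => [|k IH] f g.
  by move=> cf cg x Ux; apply: cvgM; [exact: cf | exact: cg].
move=> Cf Cg; have [df Df] := Cf; have [dg Dg] := Cg; split=> [x Ux|v].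
  by apply: differentiableM; [exact: df | exact: dg].
have Cfg := Ck_onD Uo (IH _ _ (Ck_onW Cf) (Dg v)) (IH _ _ (Ck_onW Cg) (Df v)).
apply: (eq_Ck_on Uo) Cfg => x; rewrite inE => Ux.
by rewrite deriveM //; apply: diff_derivable; [exact: df | exact: dg].
Qed.

(** The derivative - f^-2 D_v f contains 1/f undifferentiated, so the induction hypothesis on 1/f
    suffices for it. *)
Lemma Ck_onV k U (f : V -> R) : open U -> (forall x, U x -> f x != 0) ->
  Ck_on k U f -> Ck_on k U (fun x => (f x)^-1).
Proof.
move=> Uo f0; elim: k => [|k IH].
  by move=> cf x Ux; apply: cvgV; [exact: f0 | exact: cf].
move=> Cf; have [df Df] := Cf; split=> [x Ux|v].
  by apply: differentiableV; [exact: df | exact: f0].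
have CV := IH (Ck_onW Cf).
have C1 := Ck_onM Uo (Ck_onM Uo (Ck_on_cst k U (-1 : R)) (Ck_onM Uo CV CV)) (Df v).
apply: (eq_Ck_on Uo) C1 => x; rewrite inE => Ux.
rewrite deriveV; [|exact: f0|exact/diff_derivable/df].
by rewrite mulN1r -invfM.
Qed.

Lemma Ck_on_sum W I (r : seq I) (P : pred I) k U (f : I -> V -> W) : open U ->
  (forall i, Ck_on k U (f i)) -> Ck_on k U (fun x => \sum_(i <- r | P i) f i x).
Proof.
move=> Uo Cf; elim: r => [|i r IH].
  by under eq_fun do rewrite big_nil; exact: Ck_on_cst.
under eq_fun do rewrite big_cons.
by case: (P i) => //; exact: Ck_onD.
Qed.

Lemma Ck_on_prod I (r : seq I) (P : pred I) k U (f : I -> V -> R) : open U ->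
  (forall i, Ck_on k U (f i)) -> Ck_on k U (fun x => \prod_(i <- r | P i) f i x).
Proof.
move=> Uo Cf; elim: r => [|i r IH].
  by under eq_fun do rewrite big_nil; exact: Ck_on_cst.
under eq_fun do rewrite big_cons.
by case: (P i) => //; exact: Ck_onM.
Qed.

Lemma Ck_on_mxP k U m n (f : V -> 'M[R]_(m, n)) : open U ->
  Ck_on k U f <-> forall i j, Ck_on k U (fun x => f x i j : R).
Proof.
move=> Uo; split.
  elim: k f => [|k IH] f.
    move=> cf i j x Ux.
    apply: (@continuous_comp _ _ _ f (fun N : 'M[R]_(m, n) => N i j : R)).
      exact: cf.
    exact: coord_continuous.
  move=> [df Df] i j; split=> [x Ux|v]; first exact: (differentiable_mxP f x).1 (df x Ux) i j.
  apply: (eq_Ck_on Uo) (IH _ (Df v) i j) => x; rewrite inE => Ux.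
  by rewrite derive_mxE //; exact: df.
elim: k f => [|k IH] f Cf.
  move=> x Ux; apply/cvgrPdist_lt => e e0.
  suff : \forall y \near x, forall i j, `|f x i j - f y i j| < e.
    apply: filterS => y fy; rewrite /Num.Def.normr /= mx_normrE.
    by rewrite (bigmax_lt _ e0) // => -[i j] _; rewrite !mxE.
  apply: filter_forall => i; apply: filter_forall => j.
  by move/cvgrPdist_lt : (Cf i j x Ux); apply.
have df x : U x -> differentiable f x.
  by move=> Ux; apply/differentiable_mxP => i j; exact: (Cf i j).1.
split=> [x Ux|v]; first exact: df.
apply: IH => i j; apply: (eq_Ck_on Uo) ((Cf i j).2 v) => x; rewrite inE => Ux.
by rewrite derive_mxE //; exact: df.
Qed.

Lemma Ck_on_det k U n (f : V -> 'M[R]_n) : open U ->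
  (forall i j, Ck_on k U (fun x => f x i j : R)) ->
  Ck_on k U (fun x => \det (f x)).
Proof.
move=> Uo Cf; apply: Ck_on_sum => // s; apply: Ck_onM => //.
  exact: Ck_on_cst.
exact: Ck_on_prod.
Qed.

(** By Cramer's rule the entries of the inverse are cofactors divided by the determinant, hence
    rational in the entries of f. *)
Lemma Ck_on_invmx k U n (f : V -> 'M[R]_n) : open U ->
  (forall x, U x -> f x \in unitmx) ->
  (forall i j, Ck_on k U (fun x => f x i j : R)) ->
  forall i j, Ck_on k U (fun x => invmx (f x) i j : R).
Proof.
move=> Uo uf Cf i j.
have Cadj : Ck_on k U (fun x => (\adj (f x)) i j).
  under eq_fun do rewrite mxE; apply: Ck_onM => //; first exact: Ck_on_cst.
  apply: Ck_on_det => // a b; under eq_fun do rewrite !mxE; exact: Cf.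
have Cdet : Ck_on k U (fun x => (\det (f x))^-1).
  apply: Ck_onV => //; last exact: Ck_on_det.
  by move=> x /uf; rewrite unitmxE unitfE.
apply: (eq_Ck_on Uo) (Ck_onM Uo Cdet Cadj) => x; rewrite inE => Ux.
by rewrite /invmx uf // [RHS]mxE.
Qed.

End CkOn.

Lemma Ck_on_coord (R : realType) m n k (U : set 'M[R]_(m, n)) i j :
  Ck_on k U (fun x : 'M[R]_(m, n) => x i j : R).
Proof.
case: k => [|k].
  by move=> x _; rewrite /prop_for; exact: coord_continuous.
split=> [x _|v]; first exact: differentiable_coord.
rewrite [X in Ck_on k U X](_ : _ = fun _ => v i j); first exact: Ck_on_cst.
apply/funext => x.
have : ('D_v id x) i j = 'D_v (fun y : 'M[R]_(m, n) => y i j : R) x.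
  exact: derive_mxE.
by rewrite derive_id.
Qed.

Section SmoothSymmetry.
Variables (R : realType) (V : normedModType R) (U : set V) (x u v : V).
Hypotheses (Uo : open U) (Ux : U x).

Lemma smooth_on_derive_sym (f : V -> R) : smooth_on U f ->
  'D_v ('D_u f) x = 'D_u ('D_v f) x.
Proof.
move=> sf.
have sD w : smooth_on U ('D_w f) by exact: smooth_on_derive.
have sDD w w' : smooth_on U ('D_w' ('D_w f)) by exact: smooth_on_derive.
apply: (derive_derive_sym Uo Ux).
- by move=> y; exact: smooth_on_differentiable.
- by move=> w y; exact: smooth_on_differentiable.
- exact: (sDD u v 0 x Ux).
- exact: (sDD v u 0 x Ux).
Qed.

Lemma smooth_on_derive_sym_mx m n (f : V -> 'M[R]_(m, n)) : smooth_on U f ->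
  'D_v ('D_u f) x = 'D_u ('D_v f) x.
Proof.
move=> sf; apply/matrixP => i j.
have sfij : smooth_on U (fun y => f y i j : R) by move=> k; exact: (Ck_on_mxP k f Uo).1.
have sD w : smooth_on U ('D_w f) by exact: smooth_on_derive.
have DE w w' :
    'D_w' ('D_w f) x i j = 'D_w' ('D_w (fun y => f y i j : R)) x.
  rewrite derive_mxE; last exact: smooth_on_differentiable (sD w) Ux.
  apply: near_eq_derive; have : nbhs x U by exact: open_nbhs_nbhs.
  apply: filterS => y Uy; rewrite derive_mxE //.
  exact: smooth_on_differentiable sf Uy.
exact: etrans (DE u v) (etrans (smooth_on_derive_sym sfij) (esym (DE v u))).
Qed.

End SmoothSymmetry.

(** * Rows of 3 x n matrices *)

Section Rows.
Variables (R : realType) (n : nat).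
Implicit Types (w : 'rV[R]_n) (x v : 'M[R]_(3, n)).

(** Written as a left multiplication, so that linearity and the derivative are inherited from
    [mulmx]. *)
Definition inrow (a : 'I_3) w : 'M[R]_(3, n) := delta_mx a 0 *m w.

Definition mx3 w0 w1 w2 : 'M[R]_(3, n) :=
  inrow rx w0 + inrow ry1 w1 + inrow ry2 w2.

Lemma row_inrow (a b : 'I_3) w : row b (inrow a w) = (b == a)%:R *: w.
Proof.
rewrite rowE mulmxA mul_delta_mx_cond; case: eqP => _ /=.
  by rewrite mulr1n scale1r -rowE row_id.
by rewrite mulr0n mul0mx scale0r.
Qed.

Lemma inrow_delta a i : inrow a (delta_mx 0 i) = delta_mx a i.
Proof. exact: mul_delta_mx. Qed.

Lemma row_rx_mx3 w0 w1 w2 : row rx (mx3 w0 w1 w2) = w0.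
Proof. by rewrite !linearD /= !row_inrow /= scale1r !scale0r !addr0. Qed.

Lemma row_ry1_mx3 w0 w1 w2 : row ry1 (mx3 w0 w1 w2) = w1.
Proof. by rewrite !linearD /= !row_inrow /= scale1r !scale0r add0r addr0. Qed.

Lemma row_ry2_mx3 w0 w1 w2 : row ry2 (mx3 w0 w1 w2) = w2.
Proof. by rewrite !linearD /= !row_inrow /= scale1r !scale0r !add0r. Qed.

Definition row_mx3E := (row_rx_mx3, row_ry1_mx3, row_ry2_mx3).

Lemma eq_mx3 x v : row rx x = row rx v -> row ry1 x = row ry1 v ->
  row ry2 x = row ry2 v -> x = v.
Proof.
move=> e0 e1 e2; apply/row_matrixP => -[[|[|[|//]]] lt3].
- by rewrite (_ : Ordinal lt3 = rx) //; exact: val_inj.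
- by rewrite (_ : Ordinal lt3 = ry1) //; exact: val_inj.
- by rewrite (_ : Ordinal lt3 = ry2) //; exact: val_inj.
Qed.

Lemma mx3_rows x : mx3 (row rx x) (row ry1 x) (row ry2 x) = x.
Proof. by apply: eq_mx3; rewrite row_mx3E. Qed.

Lemma inrow0 a : inrow a 0 = 0.
Proof. exact: mulmx0. Qed.

Lemma row_Jtan_rx v : row rx (Jtan v) = 0.
Proof.
apply/rowP => i; rewrite !mxE big1 // => k _; rewrite mxE /= mul0r //.
Qed.

Lemma row_Jtan_ry1 v : row ry1 (Jtan v) = row rx v.
Proof.
apply/rowP => i; rewrite !mxE (bigD1 rx) //= big1 ?addr0 ?mxE ?mul1r //.
by move=> k kx; rewrite mxE /= eqSS eq_sym [_ == _](negbTE kx) mul0r.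
Qed.

Lemma row_Jtan_ry2 v : row ry2 (Jtan v) = row ry1 v.
Proof.
apply/rowP => i; rewrite !mxE (bigD1 ry1) //= big1 ?addr0 ?mxE ?mul1r //.
by move=> k kx; rewrite mxE /= eqSS eq_sym [_ == _](negbTE kx) mul0r.
Qed.

Lemma JtanE v : Jtan v = mx3 0 (row rx v) (row ry1 v).
Proof.
by apply: eq_mx3; rewrite row_mx3E ?row_Jtan_rx ?row_Jtan_ry1 ?row_Jtan_ry2.
Qed.

Lemma Liouville2E x : Liouville2 x = mx3 0 (row ry1 x) (2 *: row ry2 x).
Proof.
apply: eq_mx3; rewrite row_mx3E; apply/rowP => i; rewrite !mxE ?mul0r ?mul1r //.
Qed.

Definition spray_at x v := row rx v = row ry1 x /\ row ry1 v = 2 *: row ry2 x.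

Lemma spray_atP x v : Jtan v = Liouville2 x <-> spray_at x v.
Proof.
rewrite JtanE Liouville2E; split=> [E|[-> ->]] //.
split; [have := congr1 (row ry1) E | have := congr1 (row ry2) E];
  by rewrite !row_mx3E.
Qed.

End Rows.

Section RowCalculus.
Variables (R : realType) (V : normedModType R) (n : nat).

Lemma differentiable_inrow a (f : V -> 'rV[R]_n) (x : V) :
  differentiable f x -> differentiable (fun y => inrow a (f y)) x.
Proof.
by move=> df; exact: (differentiable_comp df (differentiable_mulmxl _ (f x))).
Qed.

Lemma derive_inrow a (f : V -> 'rV[R]_n) (x v : V) :
  differentiable f x ->
  'D_v (fun y => inrow a (f y)) x = inrow a ('D_v f x).
Proof.
move=> df; apply: etrans (derive_mulmxl (delta_mx a 0) (f x) ('D_v f x)).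
exact: (derive_comp v df (differentiable_mulmxl _ (f x))).
Qed.

Lemma mx3_calculus (f0 f1 f2 : V -> 'rV[R]_n) (x : V) :
  differentiable f0 x -> differentiable f1 x -> differentiable f2 x ->
  differentiable (fun y => mx3 (f0 y) (f1 y) (f2 y)) x /\
  forall v, 'D_v (fun y => mx3 (f0 y) (f1 y) (f2 y)) x =
    mx3 ('D_v f0 x) ('D_v f1 x) ('D_v f2 x).
Proof.
move=> d0 d1 d2.
have e0 := differentiable_inrow rx d0.
have e1 := differentiable_inrow ry1 d1.
have e2 := differentiable_inrow ry2 d2.
split=> [|v]; first exact: (differentiableD (differentiableD e0 e1) e2).
rewrite deriveD; [|exact/diff_derivable/differentiableD|exact: diff_derivable].
rewrite deriveD; [|exact: diff_derivable..].
by rewrite !derive_inrow.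
Qed.

End RowCalculus.

Lemma differentiable_row (R : realType) m n a (x : 'M[R]_(m, n)) :
  differentiable (row a) x.
Proof. rewrite (funext (rowE a)); exact: differentiable_mulmxl. Qed.

Lemma derive_row (R : realType) m n a (x v : 'M[R]_(m, n)) :
  'D_v (row a) x = row a v.
Proof. by rewrite (funext (rowE a)) derive_mulmxl. Qed.

(** * Second-order lifts of coordinate changes *)

Section Lift.
Variables (R : realType) (n : nat) (U : set 'rV[R]_n) (phi : 'rV[R]_n -> 'rV[R]_n).
Hypotheses (Uo : open U) (sphi : smooth_on U phi).

(** The last row is half of (f o rho)'' = D_(rho'') f + D_(rho') D_(rho') f. Since y2 is rho''/2,
    the first term absorbs the factor 1/2 and the second keeps it. *)
Definition lift2 (f : 'rV[R]_n -> 'rV[R]_n) (x : 'M[R]_(3, n)) : 'M[R]_(3, n) :=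
  let x0 := row rx x in let x1 := row ry1 x in let x2 := row ry2 x in
  mx3 (f x0) ('D_x1 f x0) ('D_x2 f x0 + 2^-1 *: 'D_x1 ('D_x1 f) x0).

Let dphi z : U z -> differentiable phi z.
Proof. exact: smooth_on_differentiable. Qed.

Let dDphi w z : U z -> differentiable ('D_w phi) z.
Proof. exact/smooth_on_differentiable/smooth_on_derive. Qed.

Lemma lift2_calculus (x : 'M[R]_(3, n)) : U (row rx x) ->
  differentiable (lift2 phi) x /\
  forall v : 'M[R]_(3, n),
    let x0 := row rx x in let x1 := row ry1 x in let x2 := row ry2 x in
    let v0 := row rx v in let v1 := row ry1 v in let v2 := row ry2 v in
    'D_v (lift2 phi) x =
    mx3 ('D_v0 phi x0) ('D_v1 phi x0 + 'D_v0 ('D_x1 phi) x0)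
        (('D_v2 phi x0 + 'D_v0 ('D_x2 phi) x0) +
         2^-1 *: ('D_v1 ('D_x1 phi) x0 + 'D_x1 ('D_v1 phi) x0 +
                  'D_v0 ('D_x1 ('D_x1 phi)) x0)).
Proof.
move=> Ux.
have dr a := differentiable_row a x.
pose q y := 'D_(row ry1 y) ('D_(row ry1 y) phi) (row rx y).
have M1 v := derive_dir_moving Uo dphi Ux (dr rx) (dr ry1) dDphi v.
have M2 v := derive_dir_moving Uo dphi Ux (dr rx) (dr ry2) dDphi v.
have Q v := derive_dir_moving2 Uo sphi Ux (dr rx) (dr ry1) v.
pose f0 (y : 'M[R]_(3, n)) := phi (row rx y).
pose f1 (y : 'M[R]_(3, n)) := 'D_(row ry1 y) phi (row rx y).
pose f2 (y : 'M[R]_(3, n)) := 'D_(row ry2 y) phi (row rx y) + 2^-1 *: q y.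
have d0 : differentiable f0 x by exact: (differentiable_comp (dr rx) (dphi Ux)).
have d1 : differentiable f1 x by exact: (M1 0).1.
have d2 : differentiable f2 x.
  exact: (differentiableD (M2 0).1 (differentiableZ 2^-1 (Q 0).1)).
have [dm Dm] := mx3_calculus d0 d1 d2.
have liftE : lift2 phi = fun y => mx3 (f0 y) (f1 y) (f2 y) by [].
rewrite liftE; split=> [|v /=]; first exact: dm.
rewrite (Dm v).
have -> : 'D_v f0 x = 'D_(row rx v) phi (row rx x).
  rewrite -[in RHS](derive_row rx x v).
  exact: (derive_comp v (dr rx) (dphi Ux)).
have -> : 'D_v f1 x =
    'D_(row ry1 v) phi (row rx x) + 'D_(row rx v) ('D_(row ry1 x) phi) (row rx x).
  by apply: etrans (M1 v).2 _; rewrite !derive_row.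
rewrite deriveD; [|exact/diff_derivable/(M2 0).1|
  exact/diff_derivable/differentiableZ/(Q 0).1].
rewrite deriveZ; last exact/diff_derivable/(Q 0).1.
by rewrite (M2 v).2 (Q v).2 !derive_row.
Qed.

(** Along a vector with rows y1 and 2 y2, the middle row of the lift has derivative D_(2 y2) phi +
    D_y1 D_y1 phi, which is twice the last row of the lift. *)
Lemma spray_at_lift2 (x s : 'M[R]_(3, n)) : U (row rx x) ->
  spray_at x s -> spray_at (lift2 phi x) ('D_s (lift2 phi) x).
Proof.
move=> Ux [s0 s1]; have [_ D] := lift2_calculus Ux.
rewrite /spray_at D /lift2 !row_mx3E s0 s1; split=> //.
by rewrite scalerDr scalerA divff ?pnatr_eq0 // scale1r derive_dirZ //; exact: dphi.
Qed.

(** Each summand is a parameter with its own equation, so that it can be evaluated separately when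
    some rows of v vanish. *)
Lemma derive_lift2 (x v : 'M[R]_(3, n)) a b c d e f g h : U (row rx x) ->
  let x0 := row rx x in let x1 := row ry1 x in let x2 := row ry2 x in
  let v0 := row rx v in let v1 := row ry1 v in let v2 := row ry2 v in
  'D_v0 phi x0 = a -> 'D_v1 phi x0 = b -> 'D_v0 ('D_x1 phi) x0 = c ->
  'D_v2 phi x0 = d -> 'D_v0 ('D_x2 phi) x0 = e -> 'D_v1 ('D_x1 phi) x0 = f ->
  'D_x1 ('D_v1 phi) x0 = g -> 'D_v0 ('D_x1 ('D_x1 phi)) x0 = h ->
  'D_v (lift2 phi) x = mx3 a (b + c) (d + e + 2^-1 *: (f + g + h)).
Proof.
move=> Ux x0 x1 x2 v0 v1 v2 <- <- <- <- <- <- <- <-.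
exact: (lift2_calculus Ux).2.
Qed.

Lemma derive_lift2_ry2 (x : 'M[R]_(3, n)) w : U (row rx x) ->
  'D_(inrow ry2 w) (lift2 phi) x = inrow ry2 ('D_w phi (row rx x)).
Proof.
move=> Ux.
have r0 : row rx (inrow ry2 w) = 0 by rewrite row_inrow scale0r.
have r1 : row ry1 (inrow ry2 w) = 0 by rewrite row_inrow scale0r.
have r2 : row ry2 (inrow ry2 w) = w by rewrite row_inrow scale1r.
have Z0 (f : 'rV[R]_n -> 'rV[R]_n) : 'D_(row rx (inrow ry2 w)) f (row rx x) = 0.
  by rewrite r0; exact: derive0.
have Z1 (f : 'rV[R]_n -> 'rV[R]_n) : 'D_(row ry1 (inrow ry2 w)) f (row rx x) = 0.
  by rewrite r1; exact: derive0.
have Z2 : 'D_(row ry1 x) ('D_(row ry1 (inrow ry2 w)) phi) (row rx x) = 0.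
  rewrite r1; apply: etrans (derive_cst 0 (row rx x) (row ry1 x)).
  congr (derive _ (row rx x) (row ry1 x)).
  by apply/funext => y; exact: derive0.
have W : 'D_(row ry2 (inrow ry2 w)) phi (row rx x) = 'D_w phi (row rx x).
  by rewrite r2.
apply: etrans (derive_lift2 Ux (Z0 _) (Z1 _) (Z0 _) W (Z0 _) (Z1 _) Z2 (Z0 _)) _.
by rewrite !addr0 scaler0 addr0 /mx3 !inrow0 !add0r.
Qed.

(** The quadratic term of the lift contributes half of D_w D_y1 phi + D_y1 D_w phi; by symmetry the
    two are equal and the factor 1/2 disappears. *)
Lemma derive_lift2_ry1 (x : 'M[R]_(3, n)) w : U (row rx x) ->
  'D_(inrow ry1 w) (lift2 phi) x =
  inrow ry1 ('D_w phi (row rx x)) +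
  inrow ry2 ('D_(row ry1 x) ('D_w phi) (row rx x)).
Proof.
move=> Ux.
have r0 : row rx (inrow ry1 w) = 0 by rewrite row_inrow scale0r.
have r1 : row ry1 (inrow ry1 w) = w by rewrite row_inrow scale1r.
have r2 : row ry2 (inrow ry1 w) = 0 by rewrite row_inrow scale0r.
have Z0 (f : 'rV[R]_n -> 'rV[R]_n) : 'D_(row rx (inrow ry1 w)) f (row rx x) = 0.
  by rewrite r0; exact: derive0.
have Z2 : 'D_(row ry2 (inrow ry1 w)) phi (row rx x) = 0.
  by rewrite r2; exact: derive0.
have W1 : 'D_(row ry1 (inrow ry1 w)) phi (row rx x) = 'D_w phi (row rx x).
  by rewrite r1.
have W2 : 'D_(row ry1 x) ('D_(row ry1 (inrow ry1 w)) phi) (row rx x) =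
          'D_(row ry1 x) ('D_w phi) (row rx x) by rewrite r1.
have W3 : 'D_(row ry1 (inrow ry1 w)) ('D_(row ry1 x) phi) (row rx x) =
          'D_(row ry1 x) ('D_w phi) (row rx x).
  by rewrite r1; exact: (smooth_on_derive_sym_mx _ _ Uo Ux sphi).
apply: etrans (derive_lift2 Ux (Z0 _) W1 (Z0 _) Z2 (Z0 _) W3 W2 (Z0 _)) _.
have half (b : 'rV[R]_n) : 2^-1 *: (b + b) = b.
  by rewrite scalerDr -scalerDl -[X in X + _]mul1r -[X in _ + X]mul1r -splitr scale1r.
rewrite !addr0 add0r; apply: etrans (congr1 (mx3 _ _) (half _)) _.
by rewrite /mx3 inrow0 add0r.
Qed.

End Lift.

(** * Transport of the semispray equation by a coordinate change *)

Section EulerLagrange.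
Variables (R : realType) (n : nat).
Implicit Types (l : 'M[R]_(3, n) -> R) (x s : 'M[R]_(3, n)).

(* For s = S(x) with S a semispray, this is L_S (d_{J^2} l) = d_J l at x. *)
Definition spray_equation l x s : Prop := forall w : 'rV[R]_n,
  'D_s ('D_(inrow ry2 w) l) x = 'D_(inrow ry1 w) l x.

(** Put A = D_w phi and c = D_y1 D_w phi. The y2-derivative of l along w is that of l' along the
    moving vector A, and A varies along s at the rate c because the first row of s is y1. The
    y1-derivative of l along w is that of l' along A plus a y2-derivative along c. The second
    derivatives of phi thus add the same term to both sides and cancel. *)
Lemma spray_equation_lift2 (U : set 'rV[R]_n) (phi : 'rV[R]_n -> 'rV[R]_n)
    (O O' : set 'M[R]_(3, n)) l l' x s :
  open U -> smooth_on U phi -> open O' -> smooth_on O' l' ->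
  open O -> O x ->
  (forall y, O y -> [/\ U (row rx y), O' (lift2 phi y) & l y = l' (lift2 phi y)]) ->
  (forall w', exists w, 'D_w phi (row rx x) = w') ->
  spray_at x s -> spray_equation l x s ->
  spray_equation l' (lift2 phi x) ('D_s (lift2 phi) x).
Proof.
move=> Uo sphi O'o sl' Oo Ox OP surj [s0 s1] eql w'.
have {surj}[w <-] := surj w'.
have [Ux O'x lx] := OP _ Ox.
have nbO := open_nbhs_nbhs (conj Oo Ox).
have [dPhi _] := lift2_calculus Uo sphi Ux.
have dl' z : O' z -> differentiable l' z by exact: smooth_on_differentiable.
have dDl' u z : O' z -> differentiable ('D_u l') z.
  exact/smooth_on_differentiable/smooth_on_derive.
have dDphi : differentiable ('D_w phi) (row rx x).
  exact: smooth_on_differentiable (smooth_on_derive w sphi) Ux.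
pose A y := 'D_w phi (row rx y).
have dA : differentiable A x by exact: (differentiable_comp (differentiable_row rx x) dDphi).
have DA : 'D_s A x = 'D_(row ry1 x) ('D_w phi) (row rx x).
  have := derive_comp s (differentiable_row rx x) dDphi.
  by rewrite derive_row s0; exact.
have Dl u y : O y -> 'D_u l y = 'D_('D_u (lift2 phi) y) l' (lift2 phi y).
  move=> Oy; have [Uy O'y _] := OP _ Oy.
  have nbOy := open_nbhs_nbhs (conj Oo Oy).
  have nE : \forall z \near y, l z = (l' \o lift2 phi) z.
    by apply: filterS nbOy => z Oz; have [_ _ lz] := OP _ Oz.
  rewrite (near_eq_derive u nE).
  exact: (derive_comp u (lift2_calculus Uo sphi Uy).1 (dl' _ O'y)).
have E2 y : O y -> 'D_(inrow ry2 w) l y = 'D_(inrow ry2 (A y)) l' (lift2 phi y).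
  move=> Oy; have [Uy _ _] := OP _ Oy.
  by rewrite (Dl _ y Oy) (derive_lift2_ry2 Uo sphi).
pose c := 'D_(row ry1 x) ('D_w phi) (row rx x).
have E1 : 'D_(inrow ry1 w) l x =
    'D_(inrow ry1 (A x)) l' (lift2 phi x) + 'D_(inrow ry2 c) l' (lift2 phi x).
  apply: etrans (derive_dirD (dl' _ O'x) _ _); apply: etrans (Dl _ _ Ox) _.
  by congr (derive l' _ _); exact: (derive_lift2_ry1 Uo sphi).
have nE2 : \forall y \near x,
    'D_(inrow ry2 w) l y = 'D_(inrow ry2 (A y)) l' (lift2 phi y).
  by apply: filterS nbO => y; exact: E2.
have dB := differentiable_inrow ry2 dA.
have DB : 'D_s (fun y => inrow ry2 (A y)) x = inrow ry2 c.
  apply: etrans (derive_inrow ry2 s dA) _; exact: (congr1 (inrow ry2) DA).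
have E3 : 'D_s ('D_(inrow ry2 w) l) x = 'D_(inrow ry2 c) l' (lift2 phi x) +
    'D_('D_s (lift2 phi) x) ('D_(inrow ry2 (A x)) l') (lift2 phi x).
  apply: etrans (near_eq_derive s nE2) _.
  apply: etrans (derive_dir_moving O'o dl' O'x dPhi dB dDl' s).2 _.
  by congr (derive l' _ _ + _); exact: DB.
apply: (addrI ('D_(inrow ry2 c) l' (lift2 phi x))).
exact: etrans (esym E3) (etrans (eql w) (etrans E1 (addrC _ _))).
Qed.

End EulerLagrange.

(** * Solving the semispray equation *)

Lemma inrow_sum_delta (R : realType) n a (w : 'rV[R]_n) :
  inrow a w = \sum_(i < n) w 0 i *: delta_mx a i.
Proof.
rewrite {1}(row_sum_delta w) /inrow mulmx_sumr; apply: eq_bigr => i _.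
by rewrite -scalemxAr mul_delta_mx.
Qed.

Lemma derive_dir_inrow (R : realType) n a (w : 'rV[R]_n)
    (f : 'M[R]_(3, n) -> R) x : differentiable f x ->
  'D_(inrow a w) f x = \sum_(i < n) w 0 i * partial_d a i f x.
Proof.
move=> df; rewrite inrow_sum_delta; apply: etrans (derive_dir_sum df _ _) _.
by apply: eq_bigr => i _; exact: derive_dirZ.
Qed.

Section SprayVector.
Variables (R : realType) (n : nat).
Implicit Types (l : 'M[R]_(3, n) -> R) (x s : 'M[R]_(3, n)).

Definition hess2 l x : 'M[R]_n :=
  \matrix_(i < n, j < n) (2^-1 * partial_d ry2 i (partial_d ry2 j l) x).

Definition spray_defect l x (i : 'I_n) : R :=
  dT (partial_d ry2 i l) x - partial_d ry1 i l x.

(** The last row is -3 G^j for the announced coefficients G^j, with [hess2] in the role of g_ij. *)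
Definition spray_vector l x : 'M[R]_(3, n) :=
  mx3 (row ry1 x) (2 *: row ry2 x)
    (\row_j (- 2^-1 * \sum_(i < n) invmx (hess2 l x) j i * spray_defect l x i)).

Variables (O : set 'M[R]_(3, n)) (l : 'M[R]_(3, n) -> R) (x : 'M[R]_(3, n)).
Hypotheses (Oo : open O) (sl : smooth_on O l) (Ox : O x).

Lemma hess2E i j :
  hess2 l x i j = 2^-1 * partial_d ry2 i (partial_d ry2 j l) x.
Proof. exact: mxE. Qed.

Lemma hess2_sym : (hess2 l x)^T = hess2 l x.
Proof.
apply/matrixP => i j; apply: etrans (mxE _ _ _ _) _.
apply: etrans (hess2E j i) (etrans _ (esym (hess2E i j))).
apply: congr1; exact: (smooth_on_derive_sym _ _ Oo Ox sl).
Qed.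

Let sD u : smooth_on O ('D_u l).
Proof. exact: smooth_on_derive. Qed.

(** The two prescribed rows of s assemble into d_T; the free row is paired with the full Hessian in
    y2, which is twice [hess2] because of the 1/2 in the metric. *)
Lemma derive_spray s i : spray_at x s ->
  'D_s (partial_d ry2 i l) x =
  dT (partial_d ry2 i l) x + 2 * (row ry2 s *m hess2 l x) 0 i.
Proof.
move=> [s0 s1].
have dp : differentiable (partial_d ry2 i l) x.
  exact: smooth_on_differentiable (sD _) Ox.
rewrite -{1}(mx3_rows s) s0 s1.
apply: etrans (derive_dirD dp _ _) _; congr (_ + _).
  apply: etrans (derive_dirD dp _ _) _.
  rewrite (derive_dir_inrow rx (row ry1 x) dp).
  rewrite (derive_dir_inrow ry1 (2 *: row ry2 x) dp).
  by rewrite -big_split /=; apply: eq_bigr => j _; rewrite !mxE.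
rewrite (derive_dir_inrow ry2 (row ry2 s) dp) !mxE mulr_sumr.
apply: eq_bigr => j _; rewrite !mxE mulrCA; congr (_ * _).
by rewrite mulrA divff ?pnatr_eq0 // mul1r.
Qed.

(** On the left w is the inner direction. Symmetry moves it outside, where the derivative expands
    over the basis, and each term is then exchanged back. *)
Lemma spray_equation_basis s :
  spray_equation l x s <->
  forall i, 'D_s (partial_d ry2 i l) x = partial_d ry1 i l x.
Proof.
split=> [E i|E w].
  by have := E (delta_mx 0 i); rewrite !inrow_delta.
have dl := smooth_on_differentiable sl Ox.
have dDl u := smooth_on_differentiable (sD u) Ox.
apply: etrans (smooth_on_derive_sym _ _ Oo Ox sl) _.
rewrite (derive_dir_inrow ry2 w (dDl s)) (derive_dir_inrow ry1 w dl).
apply: eq_bigr => i _; congr (_ * _); apply: etrans (E i).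
exact: (smooth_on_derive_sym _ _ Oo Ox sl).
Qed.

Hypothesis rank_hess : \rank (hess2 l x) = n.

Lemma hess2_unitmx : hess2 l x \in unitmx.
Proof. by rewrite -row_full_unit /row_full rank_hess. Qed.

Lemma spray_equationP s : spray_at x s ->
  spray_equation l x s <-> s = spray_vector l x.
Proof.
move=> sx; have uH := hess2_unitmx.
pose d : 'rV[R]_n := \row_i spray_defect l x i.
(* The formula contracts the second index of g^ji, while a row vector times the inverse contracts
   the first; symmetry of [hess2] reconciles them. *)
have accE : row ry2 (spray_vector l x) = - 2^-1 *: d *m invmx (hess2 l x).
  rewrite row_mx3E; apply/rowP => j.
  rewrite -scalemxAl !mxE; congr (_ * _); apply: eq_bigr => i _.
  rewrite !mxE mulrC; congr (_ * _).
  by rewrite -{1}hess2_sym -trmx_inv mxE.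
rewrite spray_equation_basis; split=> [E|-> i].
  have [s0 s1] := sx.
  apply: eq_mx3; rewrite ?s0 ?s1 ?accE ?row_mx3E //.
  apply: (canRL (mulmxK uH)); apply/rowP => i.
  have := E i; rewrite (derive_spray i sx) => /(canRL (addKr _)) Ei.
  apply: (mulfI (x := 2)); first by rewrite pnatr_eq0.
  rewrite Ei [in RHS]mxE mulrA mulrN divff ?pnatr_eq0 // mulN1r !mxE.
  by rewrite /spray_defect opprB addrC.
have sv : spray_at x (spray_vector l x) by split; rewrite row_mx3E.
rewrite (derive_spray i sv) accE mulmxKV // !mxE mulrA mulrN divff ?pnatr_eq0 //.
by rewrite mulN1r /spray_defect opprB addrC subrK.
Qed.

End SprayVector.

(** * Smoothness of the solution, and jets of curves *)

Section SmoothSprayVector.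
Variables (R : realType) (n : nat) (O : set 'M[R]_(3, n)).
Variable l : 'M[R]_(3, n) -> R.
Hypotheses (Oo : open O) (sl : smooth_on O l).

Lemma Ck_on_inrow a k (f : 'M[R]_(3, n) -> 'rV[R]_n) :
  (forall j, Ck_on k O (fun x => f x 0 j : R)) ->
  Ck_on k O (fun x => inrow a (f x)).
Proof.
move=> Cf; apply/(Ck_on_mxP k _ Oo) => i j.
under eq_fun do rewrite mxE.
apply: (Ck_on_sum _ _ Oo) => i0; rewrite (ord1 i0).
exact: (Ck_onM Oo (Ck_on_cst _ _ _) (Cf j)).
Qed.

Lemma Ck_on_dT k i : Ck_on k O (dT (partial_d ry2 i l)).
Proof.
have sp a : smooth_on O (partial_d a i l) by exact: smooth_on_derive.
have sD a j : smooth_on O (partial_d a j (partial_d ry2 i l)).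
  exact: (smooth_on_derive _ (sp _)).
have C a b j : Ck_on k O (fun x => x a j * partial_d b j (partial_d ry2 i l) x).
  by apply: (Ck_onM Oo); [exact: Ck_on_coord | exact: sD].
apply: (Ck_on_sum _ _ Oo) => j; apply: (Ck_onD Oo); first exact: C.
under eq_fun do rewrite -mulrA.
by apply: (Ck_onM Oo); [exact: Ck_on_cst | exact: C].
Qed.

Lemma smooth_spray_vector :
  (forall x, O x -> \rank (hess2 l x) = n) -> smooth_on O (spray_vector l).
Proof.
move=> rk k.
have sp a i : smooth_on O (partial_d a i l) by exact: smooth_on_derive.
have Ch i j : Ck_on k O (fun x => hess2 l x i j : R).
  under eq_fun do rewrite hess2E.
  apply: (Ck_onM Oo); first exact: Ck_on_cst.
  exact: (smooth_on_derive _ (sp _ _)).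
have Ci := Ck_on_invmx Oo (fun x Ox => hess2_unitmx (rk x Ox)) Ch.
have Cd i : Ck_on k O (fun x => spray_defect l x i).
  apply: (Ck_onD Oo); first exact: Ck_on_dT.
  under eq_fun do rewrite -mulN1r.
  by apply: (Ck_onM Oo); [exact: Ck_on_cst | exact: sp].
apply: (Ck_onD Oo); first apply: (Ck_onD Oo).
- apply: Ck_on_inrow => j; under eq_fun do rewrite mxE; exact: Ck_on_coord.
- apply: Ck_on_inrow => j; under eq_fun do rewrite !mxE.
  by apply: (Ck_onM Oo); [exact: Ck_on_cst | exact: Ck_on_coord].
- apply: Ck_on_inrow => j; under eq_fun do rewrite mxE.
  apply: (Ck_onM Oo); first exact: Ck_on_cst.
  by apply: (Ck_on_sum _ _ Oo) => i; apply: (Ck_onM Oo).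
Qed.

End SmoothSprayVector.

Section Curves.
Variables (R : realType) (n : nat).
Implicit Types (g : R -> 'rV[R]_n) (U : set 'rV[R]_n) (f : 'rV[R]_n -> 'rV[R]_n).

(** The regularity at 0 under which 2-jets obey the chain rule; by [curve2_comp] it survives
    composition with a smooth map. *)
Definition curve2 g : Prop :=
  (\forall t \near (0 : R), differentiable g t) /\ differentiable ('D_1 g) (0 : R).

Definition jet_mx g : 'M[R]_(3, n) :=
  mx3 (g 0) ('D_1 g 0) (2^-1 *: 'D_1 ('D_1 g) 0).

Lemma jet_mxE g : jet_mx g =
  \matrix_(a < 3, i < n) ((a`!)%:R^-1 * derive1n a g 0 0 i).
Proof.
have D1 : derive1n 1 g = 'D_1 g by apply/funext => t; exact: derive1E.
have D2 : derive1n 2 g 0 = 'D_1 ('D_1 g) 0.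
  by rewrite -D1; exact: derive1E.
apply: eq_mx3; rewrite row_mx3E; apply/rowP => i; rewrite !mxE.
- by rewrite invr1 mul1r.
- by rewrite [derive1n _ _]D1 invr1 mul1r.
- by rewrite [derive1n _ _ _]D2.
Qed.

Lemma eq_curve2 g g' : (\forall t \near (0 : R), g t = g' t) ->
  curve2 g -> curve2 g' /\ jet_mx g = jet_mx g'.
Proof.
move=> gg' [dg d2g].
(* Agreement around every nearby t, and not only at 0, makes the first derivatives agree near 0, so
   that they can be differentiated again. *)
have ngg' : \forall t \near (0 : R), \forall s \near t, g s = g' s.
  exact: (nbhs_interior gg').
have nD : \forall t \near (0 : R), 'D_1 g t = 'D_1 g' t.
  by apply: filterS ngg' => t; exact: near_eq_derive.
split; last first.
  rewrite /jet_mx (near_eq_derive _ gg') (near_eq_derive _ nD).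
  by rewrite (nbhs_singleton gg').
split; last exact: near_eq_differentiable nD d2g.
by apply: filterS2 ngg' dg => t; exact: near_eq_differentiable.
Qed.

Lemma smooth_curve2 (V : set R) g : open V -> V 0 -> smooth_on V g -> curve2 g.
Proof.
move=> Vo V0 sg; split.
  apply: filterS (open_nbhs_nbhs (conj Vo V0)) => t.
  exact: smooth_on_differentiable.
exact: smooth_on_differentiable (smooth_on_derive _ sg) V0.
Qed.

(** Near 0 the velocity of f o g is D_(g' t) f (g t), a derivative in a moving direction;
    differentiating it once more gives twice the last row of the lift. *)
Lemma curve2_comp U f g : open U -> smooth_on U f -> curve2 g -> U (g 0) ->
  curve2 (f \o g) /\ jet_mx (f \o g) = lift2 f (jet_mx g).
Proof.
move=> Uo sf [dg d2g] Ug.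
have df z : U z -> differentiable f z by exact: smooth_on_differentiable.
have d2f w z : U z -> differentiable ('D_w f) z.
  exact: smooth_on_differentiable (smooth_on_derive _ sf).
have dg0 := nbhs_singleton dg.
have nU : \forall t \near (0 : R), U (g t).
  have /differentiable_continuous cg := dg0; apply: cg.
  exact: (open_nbhs_nbhs (conj Uo Ug)).
have nD : \forall t \near (0 : R), 'D_('D_1 g t) f (g t) = 'D_1 (f \o g) t.
  apply: filterS2 nU dg => t Ut dgt; apply: esym.
  exact: (@derive_comp R R _ _ g f t 1 dgt (df _ Ut)).
have [dM DM] := derive_dir_moving Uo df Ug dg0 d2g d2f (1 : R).
split.
  split; last exact: near_eq_differentiable nD dM.
  by apply: filterS2 nU dg => t Ut dgt; exact: (differentiable_comp dgt (df _ Ut)).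
have D2 := etrans (esym (near_eq_derive (1 : R) nD)) DM.
rewrite /jet_mx /lift2 !row_mx3E -(nbhs_singleton nD) D2 scalerDr.
by rewrite (derive_dirZ (df _ Ug)).
Qed.

Lemma Ck_on_id k (V : set R) : Ck_on k V (fun t : R => t).
Proof.
case: k => [|k]; first by move=> t _; exact: cvg_id.
split=> [t _|v]; first by [].
rewrite [X in Ck_on k V X](_ : _ = fun _ => v); first exact: Ck_on_cst.
by apply/funext => t; exact: derive_id.
Qed.

(** The polynomial x + t y1 + t^2 y2 in Horner form. Its t^2 coefficient is half its second
    derivative, so its 2-jet has exactly the prescribed coordinates. *)
Definition quadratic_curve (x : 'M[R]_(3, n)) (t : R) : 'rV[R]_n :=
  row rx x + t *: (row ry1 x + t *: row ry2 x).

Lemma smooth_quadratic_curve x : smooth_on setT (quadratic_curve x).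
Proof.
move=> k; apply/(Ck_on_mxP k _ openT) => i j.
under eq_fun do rewrite !mxE.
have C (c : R) := Ck_on_cst k [set: R] c; have I := Ck_on_id k setT.
apply: (Ck_onD openT (C _)); apply: (Ck_onM openT I).
by apply: (Ck_onD openT (C _)); apply: (Ck_onM openT I).
Qed.

Lemma jet_quadratic_curve x : jet_mx (quadratic_curve x) = x.
Proof.
pose q1 (t : R) := row ry1 x + t *: row ry2 x.
have dq1 t : differentiable q1 t by exact: differentiable_line.
have did (t : R) : differentiable id t by [].
have dt t : differentiable (fun t : R => t *: q1 t) t.
  exact: (differentiable_scale (did t) (dq1 t)).
have D1 t : 'D_1 (quadratic_curve x) t = row ry1 x + t *: (2 *: row ry2 x).
  rewrite deriveD; [|exact: diff_derivable..].
  rewrite derive_cst add0r; apply: etrans (derive_scale (did t) (dq1 t) 1) _.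
  rewrite derive_id scale1r derive_line /q1 -addrA -scalerDr.
  by rewrite scaler_nat mulr2n.
have D1f : 'D_1 (quadratic_curve x) =
    fun t => row ry1 x + t *: (2 *: row ry2 x) by apply/funext => t; exact: D1.
rewrite /jet_mx D1f D1 derive_line /quadratic_curve !scale0r !addr0.
by rewrite scalerA mulVf ?pnatr_eq0 // scale1r mx3_rows.
Qed.

End Curves.

(** * Charts of the second order tangent bundle *)

Lemma loc_crd (R : realType) (k n : nat) (X : charted_space R k n) (V : zmodType)
    (c : idx X) (f : X -> V) (p : X) :
  (forall p q : X, dom c p -> dom c q -> crd c p = crd c q -> p = q) ->
  dom c p -> loc c f (crd c p) = f p.
Proof.
move=> inj cp; rewrite /loc; case: pselect => [h|[]]; last by exists p.
by case: (cid h) => q /= [cq E]; rewrite (inj _ _ cq cp E).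
Qed.

Section ManifoldCharts.
Variables (R : realType) (n : nat) (M : smooth_manifold R n).
Implicit Types (c : mchart M) (p q : M) (rho : R -> M).

Let XM := ChartedSpace (@mdom R n M) (@mcrd R n M).

Definition overlap c c' : set 'rV[R]_n := mcrd c @` (mdom c `&` mdom c').

Definition mtrans c c' : 'rV[R]_n -> 'rV[R]_n := @transition R 1 n XM c c'.

Lemma mcrd_inj c p q : mdom c p -> mdom c q -> mcrd c p = mcrd c q -> p = q.
Proof. by have [_ inj _ _] := matlas M; exact: inj. Qed.

Lemma overlap_open c c' : open (overlap c c').
Proof. by have [_ _ op _] := matlas M; exact: op. Qed.

Lemma mtrans_smooth c c' : smooth_on (overlap c c') (mtrans c c').
Proof. by have [_ _ _ sm] := matlas M; exact: sm. Qed.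

Lemma mtransE c c' p : mdom c p -> mtrans c c' (mcrd c p) = mcrd c' p.
Proof.
move=> cp; apply: (@loc_crd _ _ _ XM _ c (mcrd c') p) => // a b.
exact: mcrd_inj.
Qed.

Lemma mem_overlap c c' p : mdom c p -> mdom c' p -> overlap c c' (mcrd c p).
Proof. by move=> cp c'p; exists p. Qed.

Lemma overlap_mdom c c' p : mdom c p -> overlap c c' (mcrd c p) -> mdom c' p.
Proof. by move=> cp [q [cq c'q] E]; rewrite -(mcrd_inj cq cp E). Qed.

(** The differential of the reverse transition is a right inverse, since the two transitions compose
    to the identity near the point. *)
Lemma derive_mtrans_surj c c' p : mdom c p -> mdom c' p ->
  forall w', exists w, 'D_w (mtrans c c') (mcrd c p) = w'.
Proof.
move=> cp c'p w'; pose psi := mtrans c' c; pose y := mcrd c' p.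
have Oy : overlap c' c y by exact: mem_overlap.
have psiy : psi y = mcrd c p by exact: mtransE.
exists ('D_w' psi y).
have dpsi := smooth_on_differentiable (@mtrans_smooth c' c) Oy.
have dphi : differentiable (mtrans c c') (psi y).
  rewrite psiy; apply: smooth_on_differentiable (@mtrans_smooth c c') _.
  exact: mem_overlap.
rewrite -psiy; apply: etrans (esym (derive_comp w' dpsi dphi)) _.
apply: etrans (derive_id y w'); apply: near_eq_derive.
apply: filterS (open_nbhs_nbhs (conj (@overlap_open c' c) Oy)) => z.
by move=> [q [c'q cq] <-]; rewrite /= !mtransE.
Qed.

(** Smoothness of a curve is witnessed in one chart [c0], possibly different from [c]; the
    transition map carries the regularity over. *)
Lemma smooth_curve_chart rho c : smooth_curve rho -> mdom c (rho 0) ->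
  (\forall t \near (0 : R), mdom c (rho t)) /\ curve2 (mcrd c \o rho).
Proof.
move=> [c0 [V [Vo V0 Vc0 sV]]] c0rho.
have Vdom t : V t -> mdom c0 (rho t) by move=> Vt; apply: Vc0; exists t.
have C2 := smooth_curve2 Vo V0 sV.
have O0 : overlap c0 c ((mcrd c0 \o rho) 0) by apply: mem_overlap => //; exact: Vdom.
have nO : \forall t \near (0 : R), overlap c0 c ((mcrd c0 \o rho) t).
  have /differentiable_continuous cg := nbhs_singleton C2.1; apply: cg.
  exact: (open_nbhs_nbhs (conj (@overlap_open c0 c) O0)).
have nV := open_nbhs_nbhs (conj Vo V0).
split.
  by apply: filterS2 nO nV => t Ot /Vdom tc0; exact: overlap_mdom Ot.
have [C2c _] := curve2_comp (@overlap_open c0 c) (@mtrans_smooth c0 c) C2 O0.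
apply: (eq_curve2 _ C2c).1.
by apply: filterS nV => t /Vdom tc0; exact: mtransE.
Qed.

Lemma jet_mx_mtrans rho c c' : smooth_curve rho ->
  mdom c (rho 0) -> mdom c' (rho 0) ->
  jet_mx (mcrd c' \o rho) = lift2 (mtrans c c') (jet_mx (mcrd c \o rho)).
Proof.
move=> srho c0 c'0; have [nc C2] := smooth_curve_chart srho c0.
have O0 : overlap c c' ((mcrd c \o rho) 0) by exact: mem_overlap.
have [C2c <-] := curve2_comp (@overlap_open c c') (@mtrans_smooth c c') C2 O0.
apply: esym; apply: (eq_curve2 _ C2c).2.
by apply: filterS nc => t tc; exact: mtransE.
Qed.

End ManifoldCharts.

Section Jets.
Variables (R : realType) (n : nat) (M : smooth_manifold R n).
Implicit Types (c : mchart M) (rho sigma : R -> M) (j : jet2 M).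

Lemma same_jet2_sym rho sigma : same_jet2 rho sigma -> same_jet2 sigma rho.
Proof.
by move=> [e0 e]; split=> // c; rewrite -e0 => c0 a a2; rewrite e.
Qed.

Lemma same_jet2_trans rho sigma tau :
  same_jet2 rho sigma -> same_jet2 sigma tau -> same_jet2 rho tau.
Proof.
move=> [e0 e] [f0 f]; split=> [|c c0 a a2]; first by rewrite e0.
by rewrite e // f // -e0.
Qed.

Lemma jet_mx_same_jet2 rho sigma c : same_jet2 rho sigma -> mdom c (rho 0) ->
  jet_mx (mcrd c \o rho) = jet_mx (mcrd c \o sigma).
Proof.
move=> [_ e] c0; rewrite !jet_mxE; apply/matrixP => a i; rewrite !mxE.
by rewrite (e c c0 a) // -ltnS.
Qed.

(** Contact of order 2 can be tested in a single chart, because the lifted transition determines the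
    2-jet in every other one. *)
Lemma same_jet2_mx rho sigma c : smooth_curve rho -> smooth_curve sigma ->
  mdom c (rho 0) -> mdom c (sigma 0) ->
  jet_mx (mcrd c \o rho) = jet_mx (mcrd c \o sigma) -> same_jet2 rho sigma.
Proof.
move=> srho ssig cr cs E.
have e0 : rho 0 = sigma 0.
  apply: (mcrd_inj cr cs).
  exact: etrans (esym (row_rx_mx3 _ _ _)) (etrans (congr1 (row rx) E) (row_rx_mx3 _ _ _)).
split; [exact: e0 | move=> c' c'r a a2].
have E' : jet_mx (mcrd c' \o rho) = jet_mx (mcrd c' \o sigma).
  have c's : mdom c' (sigma 0) by rewrite -e0.
  apply: etrans (jet_mx_mtrans srho cr c'r) _.
  apply: etrans (congr1 (lift2 (mtrans c c')) E) _.
  exact: esym (jet_mx_mtrans ssig cs c's).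
have a3 : (a < 3)%N by [].
apply/rowP => i; have := congr1 (fun A : 'M[R]_(3, n) => A (Ordinal a3) i) E'.
rewrite !jet_mxE !mxE /=; apply: mulfI.
by rewrite invr_eq0 pnatr_eq0 -lt0n fact_gt0.
Qed.

Lemma jet_repr_smooth j : smooth_curve (jet_repr j).
Proof. exact: s2valP. Qed.

Lemma jet_classE j :
  jet_class j = [set sigma | smooth_curve sigma /\ same_jet2 (jet_repr j) sigma].
Proof. exact: (s2valP' (cid2 (jet_classP j))). Qed.

Lemma T2_crdE c j : crd (c : idx (T2 M)) j = jet_mx (mcrd c \o jet_repr j).
Proof. by rewrite jet_mxE. Qed.

Lemma T2_crd_inj (c : idx (T2 M)) (p q : T2 M) :
  dom c p -> dom c q -> crd c p = crd c q -> p = q.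
Proof.
move=> cp cq; rewrite !T2_crdE => E.
have same := same_jet2_mx (jet_repr_smooth p) (jet_repr_smooth q) cp cq E.
have : jet_class p = jet_class q.
  apply: etrans (jet_classE p) (etrans _ (esym (jet_classE q))).
  apply/seteqP; split=> sigma [ssig s]; apply: conj ssig _.
    exact: same_jet2_trans (same_jet2_sym same) s.
  exact: same_jet2_trans same s.
case: p {cp E same} => A Ap; case: q {cq} => B Bp /= AB.
by move: Ap; rewrite AB => Ap; rewrite (Prop_irrelevance Ap Bp).
Qed.

Definition jet_of rho (srho : smooth_curve rho) : T2 M :=
  Jet2 (ex_intro2 _ _ rho srho erefl).

(** [jet_repr] is a chosen member of the class and may differ from [rho]; only its 2-jet is
    known. *)
Lemma jet_of_same rho (srho : smooth_curve rho) :
  same_jet2 rho (jet_repr (jet_of srho)).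
Proof.
apply: same_jet2_sym.
have := jet_classE (jet_of srho); rewrite /= => E.
have : [set sigma | smooth_curve sigma /\ same_jet2 rho sigma] rho by [].
by rewrite E => -[].
Qed.

(** The rows y1 and y2 are unconstrained: the quadratic curve stays in the open chart image for
    small t and pulls back to M. Images of induced charts are therefore open. *)
Lemma T2_crd_surj c (p : M) (x : 'M[R]_(3, n)) :
  mdom c p -> row rx x = mcrd c p ->
  exists j : T2 M, dom (c : idx (T2 M)) j /\ crd (c : idx (T2 M)) j = x.
Proof.
move=> cp xp; pose O := mcrd c @` mdom c.
have Oo : open O by apply: (mcrd_open (@mdom_open _ _ _ c)) => // q.
pose g := quadratic_curve x.
have sg := smooth_quadratic_curve x.
pose V := g @^-1` O.
have Vo : open V.
  apply: open_comp Oo => t _.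
  exact/differentiable_continuous/(smooth_on_differentiable sg).
have g0 : g 0 = mcrd c p by rewrite /g /quadratic_curve scale0r addr0.
have V0 : V 0 by exists p.
(* Outside V the value p is a filler; the jet depends only on the curve near 0. *)
have [rho rhoP] : exists rho : R -> M,
    forall t, V t -> mdom c (rho t) /\ mcrd c (rho t) = g t.
  have H t : exists q, V t -> mdom c q /\ mcrd c q = g t.
    case: (pselect (V t)) => [[q cq E]|Vt]; first by exists q.
    by exists p => /Vt.
  by have [rho rhoP] := choice H; exists rho.
have srho : smooth_curve rho.
  exists c, V; split=> //; first by move=> _ [t Vt <-]; have [] := rhoP t Vt.
  apply: eq_smooth_on Vo _ (fun k => Ck_on_sub (@subsetT _ V) (sg k)) => t.
  by rewrite inE => /rhoP[_ /= ->].
have [crho _] := rhoP 0 V0.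
have same := jet_of_same srho.
exists (jet_of srho); split; first by rewrite /= -same.1.
rewrite T2_crdE -(jet_mx_same_jet2 same crho) -[RHS](jet_quadratic_curve x).
apply: (eq_curve2 _ _).2.
  apply: filterS (open_nbhs_nbhs (conj Vo V0)) => t Vt.
  exact: (rhoP t Vt).2.
exact: (smooth_curve_chart srho crho).2.
Qed.

Lemma T2_imgE (c : idx (T2 M)) : img c = row rx @^-1` (mcrd c @` mdom c).
Proof.
apply/seteqP; split=> [_ [j cj <-]|x [p cp E]].
  by exists (jet_repr j 0) => //; rewrite T2_crdE row_rx_mx3.
by have [j [cj jx]] := T2_crd_surj cp (esym E); exists j.
Qed.

Lemma T2_img_open (c : idx (T2 M)) : open (img c).
Proof.
rewrite T2_imgE; apply: open_comp.
  by move=> x _; exact/differentiable_continuous/differentiable_row.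
by apply: (mcrd_open (@mdom_open _ _ _ c)) => // q.
Qed.

End Jets.

(** * The canonical semispray *)

Lemma eq_tangent (R : realType) (k n : nat) (X : charted_space R k n) (p : X)
    (u v : tangent p) : (forall c, dom c p -> u c = v c) -> u = v.
Proof.
case: u v => [f ft f0] [g gt g0] /= E.
have fg : f = g.
  apply/funext => c; have [cp|ncp] := pselect (dom c p); first exact: E.
  by rewrite f0 // g0.
rewrite -fg in gt g0 *.
by rewrite (Prop_irrelevance ft gt) (Prop_irrelevance f0 g0).
Qed.

Lemma eq_vector_field (R : realType) (k n : nat) (X : charted_space R k n)
    (S T : vector_field X) :
  (forall p c, dom c p -> S p c = T p c) -> S = T.
Proof.
case: S T => [f fs] [g gs] /= E.
have fg : f = g by apply: functional_extensionality_dep => p; apply: eq_tangent => c; exact: E.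
by rewrite -fg in gs *; rewrite (Prop_irrelevance fs gs).
Qed.

(** * Transitions between induced charts *)

Section T2Charts.
Variables (R : realType) (n : nat) (M : smooth_manifold R n).
Implicit Types (c : idx (T2 M)) (p q : T2 M).

Definition T2_overlap c c' : set 'M[R]_(3, n) := row rx @^-1` overlap c c'.

Lemma T2_overlap_open c c' : open (T2_overlap c c').
Proof.
apply: open_comp (@overlap_open _ _ _ c c') => x _.
exact/differentiable_continuous/differentiable_row.
Qed.

Lemma T2_overlapP c c' x : T2_overlap c c' x ->
  exists p, [/\ dom c p, dom c' p & crd c p = x].
Proof.
move=> [m [cm c'm] E].
have [p [cp px]] := T2_crd_surj cm (esym E).
exists p; split; [exact: cp | | exact: px].
suff pm : jet_repr p 0 = m by rewrite /= pm.
apply: (mcrd_inj cp cm); apply: etrans (esym E).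
rewrite -px T2_crdE; exact: esym (row_rx_mx3 _ _ _).
Qed.

Lemma mem_T2_overlap c c' p : dom c p -> dom c' p -> T2_overlap c c' (crd c p).
Proof.
move=> cp c'p; suff : overlap c c' (row rx (crd c p)) by [].
rewrite T2_crdE row_rx_mx3.
exact: mem_overlap.
Qed.

Lemma T2_crd_mtrans c c' p : dom c p -> dom c' p ->
  crd c' p = lift2 (mtrans c c') (crd c p).
Proof.
move=> cp c'p; rewrite !T2_crdE.
exact: (jet_mx_mtrans (jet_repr_smooth p) cp c'p).
Qed.

Lemma T2_locE (V : zmodType) c (f : T2 M -> V) p :
  dom c p -> loc c f (crd c p) = f p.
Proof. by apply: loc_crd => a b; exact: T2_crd_inj. Qed.

(** [transition] is a lift only on the overlap, being extended by 0 off the chart image; the overlap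
    is open, which is enough to identify the differentials. *)
Lemma diff_T2_transition c c' p v : dom c p -> dom c' p ->
  'd (transition c c') (crd c p) v = 'D_v (lift2 (mtrans c c')) (crd c p).
Proof.
move=> cp c'p.
have nE : \forall y \near crd c p, lift2 (mtrans c c') y = transition c c' y.
  have := open_nbhs_nbhs (conj (@T2_overlap_open c c') (mem_T2_overlap cp c'p)).
  apply: filterS => y /T2_overlapP[q [cq c'q <-]].
  by rewrite -(T2_crd_mtrans cq c'q) /transition T2_locE.
have [dl _] := lift2_calculus (@overlap_open _ _ _ c c') (@mtrans_smooth _ _ _ c c')
  (mem_T2_overlap cp c'p).
rewrite (near_eq_derive v nE); apply: esym; apply: deriveE.
exact: near_eq_differentiable nE dl.
Qed.

End T2Charts.

(** * The Lie derivative equation in an induced chart *)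

Section SemisprayEquation.
Variables (R : realType) (n : nat) (M : smooth_manifold R n) (L : T2 M -> R).
Hypothesis L_smooth : smooth_fun L.
Implicit Types (c : idx (T2 M)) (p : T2 M) (S : vector_field (T2 M)).

Lemma vf_locE S c p : dom c p -> vf_loc S c (crd c p) = S p c.
Proof. exact: T2_locE. Qed.

Lemma semispray_at S c x : semispray S -> img c x -> spray_at x (vf_loc S c x).
Proof.
move=> sS [p cp <-]; rewrite vf_locE //.
by apply/spray_atP; exact: sS.
Qed.

Lemma Jtan_Jtan (v : 'M[R]_(3, n)) : Jtan (Jtan v) = inrow ry2 (row rx v).
Proof. by rewrite !JtanE !row_mx3E /mx3 !inrow0 !add0r. Qed.

(** The first row of S equals y1 on the whole open chart image, so the identity can be
    differentiated. J^2 retains only this row of [D_v S]. *)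
Lemma row_rx_derive_semispray S c x v : semispray S -> img c x ->
  row rx ('D_v (vf_loc S c) x) = row ry1 v.
Proof.
move=> sS cx.
have dS : differentiable (vf_loc S c) x.
  exact: smooth_on_differentiable (vf_smooth S c) cx.
rewrite -(derive_row ry1 x v) -(derive_row rx (vf_loc S c x)).
apply: etrans (esym (derive_comp v dS (differentiable_row rx _))) _.
apply: near_eq_derive.
apply: filterS (open_nbhs_nbhs (conj (@T2_img_open _ _ _ c) cx)) => y cy.
exact: (semispray_at sS cy).1.
Qed.

(** Both sides contain the y2-derivative of L along the y1-row of v: on the left from the derivative
    of S, on the right from J. What remains depends only on the x-row of v. *)
Lemma Lie_dJ2P S c x : semispray S -> img c x ->
  (forall v, Lie_derivative S (dJ2 L) c x v = dJ L c x v) <->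
  spray_equation (loc c L) x (vf_loc S c x).
Proof.
move=> sS cx; pose l : 'M[R]_(3, n) -> R := loc c L.
have dl : differentiable l x by exact: smooth_on_differentiable (L_smooth c) cx.
have LE v : Lie_derivative S (dJ2 L) c x v =
    'D_(vf_loc S c x) ('D_(inrow ry2 (row rx v)) l) x +
    'D_(inrow ry2 (row ry1 v)) l x.
  rewrite /Lie_derivative /dJ2 /form_comp /dform /= !Jtan_Jtan.
  by rewrite row_rx_derive_semispray.
have RE v : dJ L c x v =
    'D_(inrow ry1 (row rx v)) l x + 'D_(inrow ry2 (row ry1 v)) l x.
  rewrite /dJ /form_comp /dform JtanE /mx3 inrow0 add0r.
  exact: (derive_dirD dl).
split=> [E w|E v].
  have := E (inrow rx w); rewrite LE RE => /addIr.
  by rewrite row_inrow /= scale1r.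
by rewrite LE RE; congr (_ + _); exact: E.
Qed.

End SemisprayEquation.

Section CanonicalSemispray.
Variables (R : realType) (n : nat) (M : smooth_manifold R n) (L : T2 M -> R).
Hypotheses (L_smooth : smooth_fun L) (L_regular : regular L).
Implicit Types (c : idx (T2 M)) (p : T2 M).

Lemma spray_vectorP c x s : img c x -> spray_at x s ->
  spray_equation (loc c L) x s <-> s = spray_vector (loc c L) x.
Proof.
move=> cx; apply: (spray_equationP (@T2_img_open _ _ _ c) (L_smooth c) cx).
exact: (L_regular cx).
Qed.

Lemma spray_at_vector (l : 'M[R]_(3, n) -> R) x : spray_at x (spray_vector l x).
Proof. by split; rewrite row_mx3E. Qed.

Lemma spray_vector_transition c c' p : dom c p -> dom c' p ->
  spray_vector (loc c' L) (crd c' p) =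
  'd (transition c c') (crd c p) (spray_vector (loc c L) (crd c p)).
Proof.
move=> cp c'p; pose x := crd c p; pose s := spray_vector (loc c L) x.
have cx : img c x by exists p.
have Ux := mem_T2_overlap cp c'p.
have sx : spray_at x s := spray_at_vector _ _.
have Phix := T2_crd_mtrans cp c'p.
have c'x : img c' (lift2 (mtrans c c') x) by exists p.
have sPhi : spray_at (lift2 (mtrans c c') x) ('D_s (lift2 (mtrans c c')) x).
  exact: (spray_at_lift2 (@overlap_open _ _ _ c c') (@mtrans_smooth _ _ _ c c')
            Ux sx).
have eqPhi : spray_equation (loc c' L) (lift2 (mtrans c c') x)
    ('D_s (lift2 (mtrans c c')) x).
  apply: (spray_equation_lift2 (@overlap_open _ _ _ c c') (@mtrans_smooth _ _ _ c c')
    (@T2_img_open _ _ _ c') (L_smooth c') (@T2_overlap_open _ _ _ c c') Ux _ _ sx).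
  - move=> y Oy; have [q [cq c'q qy]] := T2_overlapP Oy.
    rewrite -qy; split; first exact: mem_T2_overlap.
      by rewrite -(T2_crd_mtrans cq c'q); exists q.
    rewrite -(T2_crd_mtrans cq c'q).
    exact: etrans (T2_locE L cq) (esym (T2_locE L c'q)).
  - rewrite /x T2_crdE row_rx_mx3; exact: derive_mtrans_surj.
  - exact: (spray_vectorP cx sx).2.
rewrite diff_T2_transition // Phix; apply: esym.
exact: (spray_vectorP c'x sPhi).1.
Qed.

Definition canonical_tangent_comp p c : 'M[R]_(3, n) :=
  if pselect (dom c p) then spray_vector (loc c L) (crd c p) else 0.

Lemma canonical_tangent_compE p c : dom c p ->
  canonical_tangent_comp p c = spray_vector (loc c L) (crd c p).
Proof. by rewrite /canonical_tangent_comp; case: pselect. Qed.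

Lemma canonical_tangent_comp_transition p c c' : dom c p -> dom c' p ->
  canonical_tangent_comp p c' =
  'd (transition c c') (crd c p) (canonical_tangent_comp p c).
Proof.
by move=> cp c'p; rewrite !canonical_tangent_compE //; exact: spray_vector_transition.
Qed.

Lemma canonical_tangent_comp_out p c : ~ dom c p -> canonical_tangent_comp p c = 0.
Proof. by rewrite /canonical_tangent_comp; case: pselect. Qed.

Definition canonical_tangent p : tangent p :=
  Tangent (@canonical_tangent_comp_transition p) (@canonical_tangent_comp_out p).

Lemma canonical_tangent_loc c x : img c x ->
  section_loc canonical_tangent c x = spray_vector (loc c L) x.
Proof.
by move=> [p cp <-]; rewrite /section_loc T2_locE //; exact: canonical_tangent_compE.
Qed.

Lemma canonical_tangent_smooth c :
  smooth_on (img c) (section_loc canonical_tangent c).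
Proof.
apply: eq_smooth_on (@T2_img_open _ _ _ c) _
  (smooth_spray_vector (@T2_img_open _ _ _ c) (L_smooth c) _).
  by move=> x; rewrite inE => cx; rewrite canonical_tangent_loc.
by move=> x cx; exact: (L_regular cx).
Qed.

Definition canonical_semispray : vector_field (T2 M) :=
  VectorField canonical_tangent_smooth.

Lemma semispray_canonical : semispray canonical_semispray.
Proof.
move=> p c cp; apply/spray_atP.
by rewrite /= canonical_tangent_compE //; exact: spray_at_vector.
Qed.

End CanonicalSemispray.

Theorem theorem4p1 (R : realType) (n : nat) (M : smooth_manifold R n)
    (L : T2 M -> R) (L_smooth : smooth_fun L) (L_regular : regular L) :
  exists S : vector_field (T2 M),
    [/\ semispray S,
        (forall (c : idx (T2 M)) (x : 'M[R]_(3, n)), img c x ->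
           forall j : 'I_n,
             3 * semispray_coef S c x j =
             2^-1 * \sum_(i < n) invmx (metric L c x) j i *
                      (dT (partial_d ry2 i (loc c L)) x
                       - partial_d ry1 i (loc c L) x)),
        form_eq (Lie_derivative S (dJ2 L)) (dJ L) &
        (forall S' : vector_field (T2 M), semispray S' ->
           form_eq (Lie_derivative S' (dJ2 L)) (dJ L) -> S' = S)].
Proof.
pose S := canonical_semispray L_smooth L_regular.
have sS : semispray S := semispray_canonical L_smooth L_regular.
have SE c x : img c x -> vf_loc S c x = spray_vector (loc c L) x.
  exact: canonical_tangent_loc.
exists S; split.
- exact: sS.
- move=> c x cx j; rewrite /semispray_coef SE //.
  have -> : spray_vector (loc c L) x ry2 j = row ry2 (spray_vector (loc c L) x) 0 j.
    by rewrite [RHS]mxE.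
  (* The sign of -1/3 in [semispray_coef] cancels that of -1/2 in [spray_vector]. *)
  rewrite row_ry2_mx3 mxE mulrA mulrN divff ?pnatr_eq0 // mulN1r mulNr opprK.
  by [].
- move=> c x v cx.
  apply: (Lie_dJ2P L_smooth sS cx).2.
  apply: (spray_vectorP L_smooth L_regular cx (semispray_at sS cx)).2.
  exact: SE.
- move=> S' sS' E; apply: eq_vector_field => p c cp.
  have cx : img c (crd c p) by exists p.
  rewrite -!vf_locE // SE //.
  apply: (spray_vectorP L_smooth L_regular cx (semispray_at sS' cx)).1.
  by apply: (Lie_dJ2P L_smooth sS' cx).1 => v; exact: E.
Qed.
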